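(* The following are provable in $\mathsf{RCA}_0$: (i) every proper interval order is an interval order, every proper 1-1 interval order is a 1-1 interval order, every proper closed interval order is a closed interval order, every proper 1-1 closed interval order is a 1-1 closed interval order, and every proper distinguishing interval order is a distinguishing interval order; (ii) every proper distinguishing interval order is a proper 1-1 closed interval order; (iii) every proper 1-1 interval order is a proper interval order, and every proper 1-1 closed interval order is a proper closed interval order; (iv) every proper closed interval order is a proper interval order, and every proper 1-1 closed interval order is a proper 1-1 interval order; (v) every proper interval order contains neither $\mathbf{2}\oplus\mathbf{2}$ nor $\mathbf{3}\oplus\mathbf{1}$.
   Context: $\mathsf{RCA}_0$ is the base subsystem of second-order arithmetic ($\Delta^0_1$ comprehension, $\Sigma^0_1$ induction). A partial order $\mathbf{P}=(P,\leq_P)$ is a set $P\subseteq\mathbb{N}$ with a reflexive, transitive, antisymmetric relation; a linear order has any two elements comparable; $p<_P q$ means $p\leq_P q$, $p\ne q$. Given a linear order $\mathbf{L}=(L,\leq_L)$ and $F\subseteq P\times L$, write $F(p)=\{x:(p,x)\in F\}$ and consider: (i1) each $F(p)$ nonempty and convex in $\mathbf{L}$; (i2) $p<_P q$ iff $x<_L y$ for all $x\in F(p),y\in F(q)$; (i3) $F(p)\ne F(q)$ whenever $p\ne q$; (i4) $F(p)\subseteq F(q)$ implies $F(p)=F(q)$. $\mathbf{P}$ is an interval order if some $\mathbf{L},F$ satisfy (i1),(i2); a 1-1 interval order if (i1)-(i3); a proper interval order if (i1),(i2),(i4); a proper 1-1 interval order if (i1)-(i4). Given a linear order $\mathbf{L}$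 and $f_0,f_1:P\to L$ consider: (c1) $f_0(p)\leq_L f_1(p)$; (c2) $p<_P q$ iff $f_1(p)<_L f_0(q)$; (c3) $f_0(p)\ne f_0(q)$ or $f_1(p)\ne f_1(q)$ whenever $p\ne q$; (c4) $f_i(p)\ne f_j(q)$ whenever $p\ne q$ or $i\ne j$; (c5) $f_0(p)<_L f_0(q)$ iff $f_1(p)<_L f_1(q)$. $\mathbf{P}$ is a closed interval order if some $\mathbf{L},f_0,f_1$ satisfy (c1),(c2); 1-1 closed if (c1)-(c3); distinguishing if (c1),(c2),(c4); and the proper versions of these three notions additionally require (c5) for the same $\mathbf{L},f_0,f_1$. $\mathbf{P}$ does not contain $\mathbf{2}\oplus\mathbf{2}$ if $p_0<_P q_0$, $p_1<_P q_1$ imply $p_0\leq_P q_1$ or $p_1\leq_P q_0$; it does not contain $\mathbf{3}\oplus\mathbf{1}$ if for all $p_0,p_1,p_2,q$, $p_0<_P p_1<_P p_2$ implies $p_0\leq_P q$ or $q\leq_P p_2$. *)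

(* Defs.v *)
From Stdlib Require Import List.

(** Number variables and set variables are de Bruijn indices in two independent
    index spaces: [All] binds number index 0, [SAll] binds set index 0. *)

Inductive term : Type :=
| Var (i : nat)
| Zero
| One
| Add (t u : term)
| Mul (t u : term).

Inductive form : Type :=
| Eq (t u : term)
| Lt (t u : term)
| Mem (t : term) (X : nat)
| Bot
| Imp (A B : form)
| All (A : form)
| SAll (A : form).

(** The logic is classical, so the other connectives are abbreviations. *)

Definition Neg (A : form) : form := Imp A Bot.
Definition And (A B : form) : form := Neg (Imp A (Neg B)).
Definition Or (A B : form) : form := Imp (Neg A) B.
Definition Iff (A B : form) : form := And (Imp A B) (Imp B A).
Definition Ex (A : form) : form := Neg (All (Neg A)).
Definition SEx (A : form) : form := Neg (SAll (Neg A)).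

Fixpoint tsubst (sg : nat -> term) (t : term) : term :=
  match t with
  | Var i => sg i
  | Zero => Zero
  | One => One
  | Add t u => Add (tsubst sg t) (tsubst sg u)
  | Mul t u => Mul (tsubst sg t) (tsubst sg u)
  end.

Definition tlift (t : term) : term := tsubst (fun i => Var (S i)) t.

Definition up (sg : nat -> term) (i : nat) : term :=
  match i with 0 => Var 0 | S j => tlift (sg j) end.

Definition sup (xi : nat -> nat) (i : nat) : nat :=
  match i with 0 => 0 | S j => S (xi j) end.

Fixpoint subst (sg : nat -> term) (xi : nat -> nat) (A : form) : form :=
  match A with
  | Eq t u => Eq (tsubst sg t) (tsubst sg u)
  | Lt t u => Lt (tsubst sg t) (tsubst sg u)
  | Mem t X => Mem (tsubst sg t) (xi X)
  | Bot => Bot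
  | Imp A B => Imp (subst sg xi A) (subst sg xi B)
  | All A => All (subst (up sg) xi A)
  | SAll A => SAll (subst sg (sup xi) A)
  end.

Definition lift (A : form) : form :=
  subst (fun i => Var (S i)) (fun X => X) A.
Definition slift (A : form) : form :=
  subst Var S A.
Definition inst (A : form) (t : term) : form :=
  subst (fun i => match i with 0 => t | S j => Var j end) (fun X => X) A.
Definition sinst (A : form) (X : nat) : form :=
  subst Var (fun i => match i with 0 => X | S j => j end) A.

(** Rules [P_AllI] and [P_SAllI] shift the hypotheses but not the axioms:
    an axiom with free variables stands for its universal closure. *)

Inductive proves (T : form -> Prop) : list form -> form -> Prop :=
| P_Hyp G A : In A G -> proves T G A
| P_Ax G A : T A -> proves T G A
| P_ImpI G A B : proves T (A :: G) B -> proves T G (Imp A B)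
| P_ImpE G A B : proves T G (Imp A B) -> proves T G A -> proves T G B
| P_Raa G A : proves T (Neg A :: G) Bot -> proves T G A
| P_AllI G A : proves T (map lift G) A -> proves T G (All A)
| P_AllE G A t : proves T G (All A) -> proves T G (inst A t)
| P_SAllI G A : proves T (map slift G) A -> proves T G (SAll A)
| P_SAllE G A X : proves T G (SAll A) -> proves T G (sinst A X)
| P_EqRefl G t : proves T G (Eq t t)
| P_EqE G A t u :
    proves T G (Eq t u) -> proves T G (inst A t) -> proves T G (inst A u).

Definition provable (T : form -> Prop) (A : form) : Prop := proves T nil A.

Inductive Delta00 : form -> Prop :=
| D_Eq t u : Delta00 (Eq t u)
| D_Lt t u : Delta00 (Lt t u)
| D_Mem t X : Delta00 (Mem t X)
| D_Bot : Delta00 Bot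
| D_Imp A B : Delta00 A -> Delta00 B -> Delta00 (Imp A B)
| D_AllLt t A : Delta00 A -> Delta00 (All (Imp (Lt (Var 0) (tlift t)) A))
| D_ExLt t A : Delta00 A -> Delta00 (Ex (And (Lt (Var 0) (tlift t)) A)).

Inductive Sigma01 : form -> Prop :=
| Sigma01_intro A : Delta00 A -> Sigma01 (Ex A).

Inductive Pi01 : form -> Prop :=
| Pi01_intro A : Delta00 A -> Pi01 (All A).

(** [A] with number index 0 replaced by its successor. *)
Definition at_succ (A : form) : form :=
  subst (fun i => match i with 0 => Add (Var 0) One | S _ => Var i end)
        (fun X => X) A.

Definition induction_axiom (A : form) : form :=
  Imp (And (inst A Zero) (All (Imp A (at_succ A)))) (All A).

(** The comprehended set does not occur in [A]: [slift] renames past it. *)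
Definition comprehension_axiom (A B : form) : form :=
  Imp (All (Iff A B)) (SEx (All (Iff (Mem (Var 0) 0) (slift A)))).

Inductive RCA0 : form -> Prop :=
| succ_neq0 m : RCA0 (Neg (Eq (Add m One) Zero))
| succ_inj m n : RCA0 (Imp (Eq (Add m One) (Add n One)) (Eq m n))
| add_0 m : RCA0 (Eq (Add m Zero) m)
| add_succ m n : RCA0 (Eq (Add m (Add n One)) (Add (Add m n) One))
| mul_0 m : RCA0 (Eq (Mul m Zero) Zero)
| mul_succ m n : RCA0 (Eq (Mul m (Add n One)) (Add (Mul m n) m))
| nlt_0 m : RCA0 (Neg (Lt m Zero))
| lt_succ m n : RCA0 (Iff (Lt m (Add n One)) (Or (Lt m n) (Eq m n)))
| Sigma01_induction A : Sigma01 A -> RCA0 (induction_axiom A)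
| Delta01_comprehension A B :
    Sigma01 A -> Pi01 B -> RCA0 (comprehension_axiom A B).

(** An [fexp] is a formula that still has to be told how many number and set
    quantifiers surround it. The variable bound below [m] number quantifiers
    is, at depth [n > m], the index [n - S m]; so a bound variable can be used
    as an ordinary Rocq variable and index shifting is automatic. *)

Definition nexp : Type := nat -> term.
Definition sexp : Type := nat -> nat.
Definition fexp : Type := nat -> nat -> form.

Definition e_all (A : nexp -> fexp) : fexp :=
  fun m k => All (A (fun n => Var (n - S m)) (S m) k).
Definition e_ex (A : nexp -> fexp) : fexp :=
  fun m k => Ex (A (fun n => Var (n - S m)) (S m) k).
Definition e_sall (A : sexp -> fexp) : fexp :=
  fun m k => SAll (A (fun l => l - S k) m (S k)).
Definition e_sex (A : sexp -> fexp) : fexp :=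
  fun m k => SEx (A (fun l => l - S k) m (S k)).

Definition e_eq (x y : nexp) : fexp := fun m _ => Eq (x m) (y m).
Definition e_mem (x : nexp) (X : sexp) : fexp := fun m k => Mem (x m) (X k).
Definition e_not (A : fexp) : fexp := fun m k => Neg (A m k).
Definition e_and (A B : fexp) : fexp := fun m k => And (A m k) (B m k).
Definition e_or (A B : fexp) : fexp := fun m k => Or (A m k) (B m k).
Definition e_imp (A B : fexp) : fexp := fun m k => Imp (A m k) (B m k).
Definition e_iff (A B : fexp) : fexp := fun m k => Iff (A m k) (B m k).

(** The pairing term [(x + y)^2 + x]. *)
Definition e_pair (x y : nexp) : nexp :=
  fun m => Add (Mul (Add (x m) (y m)) (Add (x m) (y m))) (x m).

Definition sentence (A : fexp) : form := A 0 0.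

Declare Scope fexp_scope.
Delimit Scope fexp_scope with F.
Bind Scope fexp_scope with fexp.

Notation "⟨ x , y ⟩" := (e_pair x y) (at level 0) : fexp_scope.
Notation "x ≐ y" := (e_eq x y) (at level 70) : fexp_scope.
Notation "x ≠ y" := (e_not (e_eq x y)) (at level 70) : fexp_scope.
Notation "x ∈ X" := (e_mem x X) (at level 70) : fexp_scope.
Notation "¬ A" := (e_not A) (at level 75, right associativity) : fexp_scope.
Notation "A ∧ B" := (e_and A B) (at level 80, right associativity) : fexp_scope.
Notation "A ∨ B" := (e_or A B) (at level 85, right associativity) : fexp_scope.
Notation "A → B" := (e_imp A B)
  (at level 99, B at level 200, right associativity) : fexp_scope.
Notation "A ↔ B" := (e_iff A B) (at level 95, no associativity) : fexp_scope.
Notation "∀ x .. y , A" := (e_all (fun x => .. (e_all (fun y => A)) ..))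
  (at level 200, x binder, y binder, right associativity) : fexp_scope.
Notation "∃ x .. y , A" := (e_ex (fun x => .. (e_ex (fun y => A)) ..))
  (at level 200, x binder, y binder, right associativity) : fexp_scope.
Notation "∀₂ X .. Y , A" := (e_sall (fun X => .. (e_sall (fun Y => A)) ..))
  (at level 200, X binder, Y binder, right associativity) : fexp_scope.
Notation "∃₂ X .. Y , A" := (e_sex (fun X => .. (e_sex (fun Y => A)) ..))
  (at level 200, X binder, Y binder, right associativity) : fexp_scope.

Local Open Scope fexp_scope.

Definition sub_prod (R A B : sexp) : fexp :=
  ∀ n, n ∈ R → ∃ x y, x ∈ A ∧ y ∈ B ∧ n ≐ ⟨x, y⟩.

Definition le (R : sexp) (x y : nexp) : fexp := ⟨x, y⟩ ∈ R.
Definition lt (R : sexp) (x y : nexp) : fexp := le R x y ∧ x ≠ y.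

Definition partial_order (P R : sexp) : fexp :=
  sub_prod R P P
  ∧ (∀ x, x ∈ P → le R x x)
  ∧ (∀ x y z, x ∈ P → y ∈ P → z ∈ P → le R x y → le R y z → le R x z)
  ∧ (∀ x y, x ∈ P → y ∈ P → le R x y → le R y x → x ≐ y).

Definition linear_order (L S : sexp) : fexp :=
  partial_order L S
  ∧ (∀ x y, x ∈ L → y ∈ L → le S x y ∨ le S y x).

Definition func (f A B : sexp) : fexp :=
  sub_prod f A B
  ∧ (∀ x, x ∈ A → ∃ y, ⟨x, y⟩ ∈ f ∧ (∀ z, ⟨x, z⟩ ∈ f → z ≐ y)).

(** [values f p g q Q] expresses [Q (f p) (g q)]. *)
Definition values (f : sexp) (p : nexp) (g : sexp) (q : nexp)
    (Q : nexp -> nexp -> fexp) : fexp :=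
  ∃ x y, ⟨p, x⟩ ∈ f ∧ ⟨q, y⟩ ∈ g ∧ Q x y.

(** [F(p)] is the section of [F] at [p], and is never formed as a set. *)

Definition i1 (P L S F : sexp) : fexp :=
  ∀ p, p ∈ P →
    (∃ x, ⟨p, x⟩ ∈ F)
    ∧ (∀ x y z, ⟨p, x⟩ ∈ F → ⟨p, y⟩ ∈ F → z ∈ L →
         le S x z → le S z y → ⟨p, z⟩ ∈ F).

Definition i2 (P R S F : sexp) : fexp :=
  ∀ p q, p ∈ P → q ∈ P →
    (lt R p q ↔ (∀ x y, ⟨p, x⟩ ∈ F → ⟨q, y⟩ ∈ F → lt S x y)).

Definition sub_section (F : sexp) (p q : nexp) : fexp :=
  ∀ x, ⟨p, x⟩ ∈ F → ⟨q, x⟩ ∈ F.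

Definition eq_section (F : sexp) (p q : nexp) : fexp :=
  ∀ x, ⟨p, x⟩ ∈ F ↔ ⟨q, x⟩ ∈ F.

Definition i3 (P F : sexp) : fexp :=
  ∀ p q, p ∈ P → q ∈ P → p ≠ q → ¬ eq_section F p q.

Definition i4 (P F : sexp) : fexp :=
  ∀ p q, p ∈ P → q ∈ P → sub_section F p q → eq_section F p q.

Definition interval_order (P R : sexp) : fexp :=
  ∃₂ L S F, linear_order L S ∧ sub_prod F P L ∧ i1 P L S F ∧ i2 P R S F.

Definition one_one_interval_order (P R : sexp) : fexp :=
  ∃₂ L S F, linear_order L S ∧ sub_prod F P L
    ∧ i1 P L S F ∧ i2 P R S F ∧ i3 P F.

Definition proper_interval_order (P R : sexp) : fexp :=
  ∃₂ L S F, linear_order L S ∧ sub_prod F P L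
    ∧ i1 P L S F ∧ i2 P R S F ∧ i4 P F.

Definition proper_one_one_interval_order (P R : sexp) : fexp :=
  ∃₂ L S F, linear_order L S ∧ sub_prod F P L
    ∧ i1 P L S F ∧ i2 P R S F ∧ i3 P F ∧ i4 P F.

Definition c1 (P S f0 f1 : sexp) : fexp :=
  ∀ p, p ∈ P → values f0 p f1 p (le S).

Definition c2 (P R S f0 f1 : sexp) : fexp :=
  ∀ p q, p ∈ P → q ∈ P → (lt R p q ↔ values f1 p f0 q (lt S)).

Definition value_neq (f : sexp) (p : nexp) (g : sexp) (q : nexp) : fexp :=
  values f p g q (fun x y => x ≠ y).

Definition c3 (P f0 f1 : sexp) : fexp :=
  ∀ p q, p ∈ P → q ∈ P → p ≠ q → value_neq f0 p f0 q ∨ value_neq f1 p f1 q.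

(** One conjunct for each choice of [i], [j] in [f_i(p) <> f_j(q)]. *)
Definition c4 (P f0 f1 : sexp) : fexp :=
  ∀ p q, p ∈ P → q ∈ P →
    (p ≠ q → value_neq f0 p f0 q)
    ∧ (p ≠ q → value_neq f1 p f1 q)
    ∧ value_neq f0 p f1 q
    ∧ value_neq f1 p f0 q.

Definition c5 (P S f0 f1 : sexp) : fexp :=
  ∀ p q, p ∈ P → q ∈ P → (values f0 p f0 q (lt S) ↔ values f1 p f1 q (lt S)).

Definition closed_interval_order (P R : sexp) : fexp :=
  ∃₂ L S f0 f1, linear_order L S ∧ func f0 P L ∧ func f1 P L
    ∧ c1 P S f0 f1 ∧ c2 P R S f0 f1.

Definition one_one_closed_interval_order (P R : sexp) : fexp :=
  ∃₂ L S f0 f1, linear_order L S ∧ func f0 P L ∧ func f1 P L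
    ∧ c1 P S f0 f1 ∧ c2 P R S f0 f1 ∧ c3 P f0 f1.

Definition distinguishing_interval_order (P R : sexp) : fexp :=
  ∃₂ L S f0 f1, linear_order L S ∧ func f0 P L ∧ func f1 P L
    ∧ c1 P S f0 f1 ∧ c2 P R S f0 f1 ∧ c4 P f0 f1.

Definition proper_closed_interval_order (P R : sexp) : fexp :=
  ∃₂ L S f0 f1, linear_order L S ∧ func f0 P L ∧ func f1 P L
    ∧ c1 P S f0 f1 ∧ c2 P R S f0 f1 ∧ c5 P S f0 f1.

Definition proper_one_one_closed_interval_order (P R : sexp) : fexp :=
  ∃₂ L S f0 f1, linear_order L S ∧ func f0 P L ∧ func f1 P L
    ∧ c1 P S f0 f1 ∧ c2 P R S f0 f1 ∧ c3 P f0 f1 ∧ c5 P S f0 f1.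

Definition proper_distinguishing_interval_order (P R : sexp) : fexp :=
  ∃₂ L S f0 f1, linear_order L S ∧ func f0 P L ∧ func f1 P L
    ∧ c1 P S f0 f1 ∧ c2 P R S f0 f1 ∧ c4 P f0 f1 ∧ c5 P S f0 f1.

Definition no_two_plus_two (P R : sexp) : fexp :=
  ∀ p0 q0 p1 q1, p0 ∈ P → q0 ∈ P → p1 ∈ P → q1 ∈ P →
    lt R p0 q0 → lt R p1 q1 → le R p0 q1 ∨ le R p1 q0.

Definition no_three_plus_one (P R : sexp) : fexp :=
  ∀ p0 p1 p2 q, p0 ∈ P → p1 ∈ P → p2 ∈ P → q ∈ P →
    lt R p0 p1 → lt R p1 p2 → le R p0 q ∨ le R q p2.

Definition every (A B : sexp -> sexp -> fexp) : form :=
  sentence (∀₂ P R, partial_order P R → A P R → B P R).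

(* Main.v *)
(** The calculus is complete for structures with a number sort and a set sort
    (Henkin construction on the terms and the set variables), so each sentence
    may be proved by reasoning about an arbitrary model of RCA0.

    The three implications that do not just drop conjuncts:
    - from endpoints to sections, put F(p) = {x : f0(p) <= x <= f1(p)}. The existence of
      F is Delta01 comprehension, as the graphs of f0, f1 allow both "for some"
      and "for all" endpoints; (c5) makes F(p) included in F(q) force equal endpoints.
    - if p0 < q0 and p1 < q1 but neither p0 <= q1 nor p1 <= q0, points of the
      sections form a cycle x < y' <= x' < y <= x.
    - if q is incomparable to p0 < p1 < p2, convexity puts F(p1) strictly inside
      F(q), against (i4). *)

From Stdlib Require Import List Arith Lia Classical ClassicalEpsilon FunctionalExtensionality.
From Stdlib Require Import PropExtensionality Cantor Ring.
Require Import Defs.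

(** * Substitution *)

Lemma tsubst_comp sg' sg t :
  tsubst sg' (tsubst sg t) = tsubst (fun i => tsubst sg' (sg i)) t.
Proof. induction t; simpl; congruence. Qed.

Lemma tsubst_Var t : tsubst Var t = t.
Proof. induction t; simpl; congruence. Qed.

Lemma up_comp sg' sg :
  (fun i => tsubst (up sg') (up sg i)) = up (fun i => tsubst sg' (sg i)).
Proof.
extensionality i; destruct i; simpl; auto.
unfold tlift; now rewrite !tsubst_comp.
Qed.

Lemma up_Var : up Var = Var.
Proof. extensionality i; now destruct i. Qed.

Lemma sup_comp xi' xi : (fun X => sup xi' (sup xi X)) = sup (fun X => xi' (xi X)).
Proof. extensionality i; now destruct i. Qed.

Lemma sup_id : sup (fun X => X) = fun X => X.
Proof. extensionality i; now destruct i. Qed.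

Lemma subst_comp sg' xi' sg xi A :
  subst sg' xi' (subst sg xi A) =
  subst (fun i => tsubst sg' (sg i)) (fun X => xi' (xi X)) A.
Proof.
revert sg' xi' sg xi; induction A; intros; simpl; rewrite ?tsubst_comp; auto.
- now rewrite IHA1, IHA2.
- now rewrite IHA, up_comp.
- now rewrite IHA, sup_comp.
Qed.

Lemma subst_Var A : subst Var (fun X => X) A = A.
Proof.
induction A; simpl; rewrite ?tsubst_Var, ?up_Var, ?sup_id; congruence.
Qed.

(** After [subst_comp] both sides are single substitutions into the same formula, so it is enough to
    compare these at index 0 and at a successor. *)
Ltac subst_eq :=
  intros; unfold lift, slift, inst, sinst, at_succ; rewrite ?subst_comp;
  f_equal;
  let i := fresh "i" in extensionality i; destruct i; simpl;
  unfold tlift; rewrite ?tsubst_comp; simpl; rewrite ?tsubst_Var; auto.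

Lemma tsubst_tlift sg t : tsubst (up sg) (tlift t) = tlift (tsubst sg t).
Proof. unfold tlift; now rewrite !tsubst_comp. Qed.

Lemma subst_lift sg xi A : subst (up sg) xi (lift A) = lift (subst sg xi A).
Proof. subst_eq. Qed.

Lemma subst_slift sg xi A : subst sg (sup xi) (slift A) = slift (subst sg xi A).
Proof. subst_eq. Qed.

Lemma subst_inst sg xi A t :
  subst sg xi (inst A t) = inst (subst (up sg) xi A) (tsubst sg t).
Proof. subst_eq. Qed.

Lemma subst_sinst sg xi A X :
  subst sg xi (sinst A X) = sinst (subst sg (sup xi) A) (xi X).
Proof. subst_eq. Qed.

Lemma subst_at_succ sg xi A :
  subst (up sg) xi (at_succ A) = at_succ (subst (up sg) xi A).
Proof. subst_eq. Qed.

Lemma Delta00_subst A : Delta00 A -> forall sg xi, Delta00 (subst sg xi A).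
Proof.
induction 1; intros; try (constructor; auto; fail).
- simpl; rewrite tsubst_tlift; now constructor.
- cbn [subst Ex And Neg tsubst up]; rewrite tsubst_tlift.
  now apply (D_ExLt (tsubst sg t)).
Qed.

(** Each axiom scheme ranges over all terms or formulas of a class closed under substitution. Since
    [P_AllI] does not shift axioms, this closure is what makes derivations stable under
    substitution. *)
Lemma RCA0_subst A sg xi : RCA0 A -> RCA0 (subst sg xi A).
Proof.
destruct 1; try (simpl; constructor; fail).
- unfold induction_axiom; simpl.
  rewrite subst_inst, subst_at_succ; apply (Sigma01_induction (subst (up sg) xi A)).
  destruct H; simpl; constructor; now apply Delta00_subst.
- unfold comprehension_axiom; simpl; rewrite subst_slift.
  apply (Delta01_comprehension (subst (up sg) xi A) (subst (up sg) xi B)).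
  + destruct H; simpl; constructor; now apply Delta00_subst.
  + destruct H0; simpl; constructor; now apply Delta00_subst.
Qed.

(** * Semantics *)

(** Set variables range over an arbitrary second sort, as in Henkin semantics, so that a
    completeness theorem is available. *)
Record structure := {
  num : Type;
  zero : num;
  one : num;
  add : num -> num -> num;
  mul : num -> num -> num;
  less : num -> num -> Prop;
  set : Type;
  mem : num -> set -> Prop
}.

Arguments zero {_}.
Arguments one {_}.
Arguments add {_}.
Arguments mul {_}.
Arguments less {_}.
Arguments mem {_}.

Definition scons {X : Type} (x : X) (s : nat -> X) (i : nat) : X :=
  match i with 0 => x | S j => s j end.

Fixpoint eval {M : structure} (rho : nat -> num M) (t : term) : num M :=
  match t with
  | Var i => rho i
  | Zero => zero
  | One => one
  | Add t u => add (eval rho t) (eval rho u)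
  | Mul t u => mul (eval rho t) (eval rho u)
  end.

Fixpoint sat {M : structure} (rho : nat -> num M) (chi : nat -> set M) (A : form)
    : Prop :=
  match A with
  | Eq t u => eval rho t = eval rho u
  | Lt t u => less (eval rho t) (eval rho u)
  | Mem t X => mem (eval rho t) (chi X)
  | Bot => False
  | Imp A B => sat rho chi A -> sat rho chi B
  | All A => forall d, sat (scons d rho) chi A
  | SAll A => forall X, sat rho (scons X chi) A
  end.

Definition models (M : structure) (T : form -> Prop) : Prop :=
  forall A, T A -> forall (rho : nat -> num M) chi, sat rho chi A.

(** * Completeness *)

Definition code (a b : nat) : nat := to_nat (a, b).

Lemma code_inj a b c d : code a b = code c d -> a = c /\ b = d.
Proof. intro H; apply (to_nat_inj (a, b) (c, d)) in H; injection H; auto. Qed.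

Fixpoint term_code (t : term) : nat :=
  match t with
  | Var i => code 0 i
  | Zero => code 1 0
  | One => code 2 0
  | Add t u => code 3 (code (term_code t) (term_code u))
  | Mul t u => code 4 (code (term_code t) (term_code u))
  end.

Fixpoint form_code (A : form) : nat :=
  match A with
  | Eq t u => code 0 (code (term_code t) (term_code u))
  | Lt t u => code 1 (code (term_code t) (term_code u))
  | Mem t X => code 2 (code (term_code t) X)
  | Bot => code 3 0
  | Imp A B => code 4 (code (form_code A) (form_code B))
  | All A => code 5 (form_code A)
  | SAll A => code 6 (form_code A)
  end.

Ltac uncode := repeat match goal with
  | H : code _ _ = code _ _ |- _ => apply code_inj in H; destruct H
  end; subst; try discriminate.

Lemma term_code_inj t u : term_code t = term_code u -> t = u.
Proof.
revert u; induction t; destruct u; cbn [term_code]; intro; uncode; f_equal; auto.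
Qed.

Lemma form_code_inj A B : form_code A = form_code B -> A = B.
Proof.
revert B; induction A; destruct B; cbn [form_code]; intro; uncode;
  f_equal; auto using term_code_inj.
Qed.

(** A left inverse of [form_code]; a number that codes nothing yields an unspecified formula, which
    the construction below tolerates. *)
Definition nth_form (n : nat) : form :=
  epsilon (inhabits Bot) (fun A => form_code A = n).

Lemma nth_form_code A : nth_form (form_code A) = A.
Proof.
apply form_code_inj, (epsilon_spec (inhabits Bot) (fun B => form_code B = form_code A)).
now exists A.
Qed.

(** * Completeness for an axiom set closed under substitution *)

Section Completeness.

Context (T : form -> Prop) (T_subst : forall A sg xi, T A -> T (subst sg xi A)).

Lemma proves_subst G A :
  proves T G A -> forall sg xi, proves T (map (subst sg xi) G) (subst sg xi A).
Proof.
induction 1; intros sg xi; simpl in *.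
- apply P_Hyp, in_map; auto.
- apply P_Ax; auto.
- apply P_ImpI; auto.
- eapply P_ImpE; eauto.
- apply P_Raa, IHproves.
- apply P_AllI; specialize (IHproves (up sg) xi); rewrite map_map in *.
  now erewrite map_ext; [exact IHproves|intro; symmetry; apply subst_lift].
- rewrite subst_inst; apply P_AllE; auto.
- apply P_SAllI; specialize (IHproves sg (sup xi)); rewrite map_map in *.
  now erewrite map_ext; [exact IHproves|intro; symmetry; apply subst_slift].
- rewrite subst_sinst; apply P_SAllE; auto.
- apply P_EqRefl.
- rewrite subst_inst; eapply P_EqE; eauto.
  rewrite <- subst_inst; auto.
Qed.

Lemma proves_weaken G A : proves T G A -> forall G', incl G G' -> proves T G' A.
Proof.
induction 1; intros G' HG.
- apply P_Hyp; auto.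
- now apply P_Ax.
- apply P_ImpI, IHproves; intros x [|]; simpl; auto.
- eapply P_ImpE; eauto.
- apply P_Raa, IHproves; intros x [|]; simpl; auto.
- apply P_AllI, IHproves, incl_map, HG.
- apply P_AllE; auto.
- apply P_SAllI, IHproves, incl_map, HG.
- apply P_SAllE; auto.
- apply P_EqRefl.
- eapply P_EqE; eauto.
Qed.

(** A bound beyond which a substitution has no effect takes the place of a syntactic notion of free
    variable. *)
Lemma tsubst_finite t : exists N, forall sg sg',
  (forall i, i < N -> sg i = sg' i) -> tsubst sg t = tsubst sg' t.
Proof.
induction t as [i| | |t [N1 H1] u [N2 H2]|t [N1 H1] u [N2 H2]]; simpl.
- exists (S i); auto.
- now exists 0.
- now exists 0.
- exists (N1 + N2); intros; f_equal; [apply H1|apply H2]; intros; apply H; lia.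
- exists (N1 + N2); intros; f_equal; [apply H1|apply H2]; intros; apply H; lia.
Qed.

Lemma subst_finite A : exists N, forall sg sg' xi xi',
  (forall i, i < N -> sg i = sg' i) -> (forall i, i < N -> xi i = xi' i) ->
  subst sg xi A = subst sg' xi' A.
Proof.
induction A as [t u|t u|t X| |A [N1 H1] B [N2 H2]|A [N H]|A [N H]]; simpl.
- destruct (tsubst_finite t) as [N1 H1], (tsubst_finite u) as [N2 H2].
  exists (N1 + N2); intros; f_equal; [apply H1|apply H2]; intros; apply H; lia.
- destruct (tsubst_finite t) as [N1 H1], (tsubst_finite u) as [N2 H2].
  exists (N1 + N2); intros; f_equal; [apply H1|apply H2]; intros; apply H; lia.
- destruct (tsubst_finite t) as [N1 H1].
  exists (N1 + S X); intros; f_equal; [apply H1; intros; apply H|apply H0]; lia.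
- now exists 0.
- exists (N1 + N2); intros.
  f_equal; [apply H1|apply H2]; intros; [apply H|apply H0|apply H|apply H0]; lia.
- exists N; intros sg sg' xi xi' Hsg Hxi; f_equal; apply H; auto.
  intros [|i] Hi; simpl; auto; rewrite Hsg; auto; lia.
- exists N; intros sg sg' xi xi' Hsg Hxi; f_equal; apply H; auto.
  intros [|i] Hi; simpl; auto; rewrite Hxi; auto; lia.
Qed.

(** Non-occurrence of [z], both as a free number index and as a free set index, expressed through
    the action of substitutions. *)
Definition fresh (z : nat) (A : form) : Prop :=
  forall sg sg' xi xi', (forall i, i <> z -> sg i = sg' i) ->
    (forall i, i <> z -> xi i = xi' i) -> subst sg xi A = subst sg' xi' A.

Lemma exists_fresh G : exists z, forall A, In A G -> fresh z A.
Proof.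
(* Asking for all sufficiently large [z] lets the bounds of the single formulas be added up. *)
enough (exists N, forall z, N <= z -> forall A, In A G -> fresh z A)
  as [N H] by eauto.
induction G as [|A G [N IH]]; [exists 0; intros z Hz A []|].
destruct (subst_finite A) as [N' H'].
exists (N + N'); intros z Hz B [<-|HB] sg sg' xi xi' H H0.
- apply H'; intros; [apply H|apply H0]; lia.
- apply (IH z); auto; lia.
Qed.

(** Renaming [z] to the newly bound index, and shifting everything else, sends
    [inst B (Var z)] back to [B] and acts on the hypotheses as [lift]. *)
Lemma fresh_AllI G B z :
  (forall A, In A (All B :: G) -> fresh z A) ->
  proves T G (inst B (Var z)) -> proves T G (All B).
Proof.
intros Hz H; apply P_AllI.
set (sg := fun i => if Nat.eq_dec i z then Var 0 else Var (S i)).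
apply proves_subst with (sg := sg) (xi := fun X => X) in H.
replace B with (subst sg (fun X => X) (inst B (Var z))).
- erewrite map_ext_in; [exact H|].
  intros A HA; apply Hz; [simpl; auto| |auto].
  intros i Hi; unfold sg; destruct (Nat.eq_dec i z); congruence.
(* As [z] is fresh for [All B], renaming and shifting agree there; stripping the quantifier gives
   the same for [B], with [up] around both substitutions. *)
- assert (HB : subst (fun i => Var (S i)) (fun X => X) (All B) =
               subst sg (fun X => X) (All B)).
  { apply Hz; [simpl; auto| |auto].
    intros i Hi; unfold sg; destruct (Nat.eq_dec i z); congruence. }
  injection HB as HB; rewrite subst_inst, <- HB; simpl; unfold sg at 1.
  destruct (Nat.eq_dec z z); [|congruence].
  rewrite <- (subst_Var B) at 2; unfold inst; rewrite subst_comp; f_equal.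
  extensionality i; now destruct i.
Qed.

Lemma fresh_SAllI G B z :
  (forall A, In A (SAll B :: G) -> fresh z A) ->
  proves T G (sinst B z) -> proves T G (SAll B).
Proof.
intros Hz H; apply P_SAllI.
set (xi := fun i => if Nat.eq_dec i z then 0 else S i).
apply proves_subst with (sg := Var) (xi := xi) in H.
replace B with (subst Var xi (sinst B z)).
- erewrite map_ext_in; [exact H|].
  intros A HA; apply Hz; [simpl; auto|auto|].
  intros i Hi; unfold xi; destruct (Nat.eq_dec i z); congruence.
- assert (HB : subst Var S (SAll B) = subst Var xi (SAll B)).
  { apply Hz; [simpl; auto|auto|].
    intros i Hi; unfold xi; destruct (Nat.eq_dec i z); congruence. }
  injection HB as HB; rewrite subst_sinst, <- HB; simpl; unfold xi at 1.
  destruct (Nat.eq_dec z z); [|congruence].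
  rewrite <- (subst_Var B) at 2; unfold sinst; rewrite subst_comp; f_equal.
  extensionality i; now destruct i.
Qed.

Lemma proves_cut G A B : proves T G A -> proves T (A :: G) B -> proves T G B.
Proof. intros; eapply P_ImpE; eauto; now apply P_ImpI. Qed.

Lemma proves_weaken1 G A B : proves T G B -> proves T (A :: G) B.
Proof. intro; eapply proves_weaken; eauto; apply incl_tl, incl_refl. Qed.

Lemma proves_bot G A : proves T G Bot -> proves T G A.
Proof. intro; apply P_Raa, proves_weaken1; auto. Qed.

Definition consistent G := ~ proves T G Bot.

(** One step of the Lindenbaum-Henkin construction: [A] is refuted or adopted, and an adopted
    negated universal formula brings along a variable as counterexample. *)
Definition step_spec (G : list form) (A : form) (G' : list form) : Prop :=
  incl G G' /\ consistent G' /\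
  (proves T G' (Neg A) \/
   In A G' /\
   (forall B, A = Neg (All B) -> exists z, In (Neg (inst B (Var z))) G') /\
   (forall B, A = Neg (SAll B) -> exists z, In (Neg (sinst B z)) G')).

(** If [A] is inconsistent with [G], then [G] refutes it. Otherwise [A] is added. A counterexample
    at a fresh [z] stays consistent: a contradiction would prove the instance at [z], hence the
    universal formula by generalisation, against its negation. *)
Lemma henkin_step G A : consistent G -> exists G', step_spec G A G'.
Proof.
intro HG; destruct (classic (proves T (A :: G) Bot)) as [HA|HA].
{ exists G; repeat split; auto using incl_refl; left; now apply P_ImpI. }
destruct (classic (exists B, A = Neg (All B))) as [[B ->]|HB].
{ destruct (exists_fresh (All B :: Neg (All B) :: G)) as [z Hz].
  exists (Neg (inst B (Var z)) :: Neg (All B) :: G); split; [|split].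
  - apply incl_tl, incl_tl, incl_refl.
  - intro H; apply P_Raa, fresh_AllI in H; auto.
    apply HA; eapply P_ImpE; eauto; apply P_Hyp; simpl; auto.
  - right; split; [simpl; auto|split]; intros C [=]; subst C.
    exists z; simpl; auto. }
destruct (classic (exists B, A = Neg (SAll B))) as [[B ->]|HB'].
{ destruct (exists_fresh (SAll B :: Neg (SAll B) :: G)) as [z Hz].
  exists (Neg (sinst B z) :: Neg (SAll B) :: G); split; [|split].
  - apply incl_tl, incl_tl, incl_refl.
  - intro H; apply P_Raa, fresh_SAllI in H; auto.
    apply HA; eapply P_ImpE; eauto; apply P_Hyp; simpl; auto.
  - right; split; [simpl; auto|split]; intros C [=]; subst C.
    exists z; simpl; auto. }
exists (A :: G); split; [apply incl_tl, incl_refl|split; auto].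
right; split; [simpl; auto|split]; intros B HAB; [destruct HB|destruct HB']; eauto.
Qed.

(** * The complete Henkin theory and its term model *)

Section Henkin.

Context (G0 : list form) (G0_consistent : consistent G0).

Fixpoint stage (n : nat) : list form :=
  match n with
  | 0 => G0
  | S n => epsilon (inhabits nil) (step_spec (stage n) (nth_form n))
  end.

Lemma stage_spec n :
  consistent (stage n) -> step_spec (stage n) (nth_form n) (stage (S n)).
Proof.
intro H; exact (epsilon_spec (inhabits nil) (step_spec (stage n) (nth_form n))
  (henkin_step _ _ H)).
Qed.

Lemma stage_consistent n : consistent (stage n).
Proof. induction n; [exact G0_consistent|now apply stage_spec]. Qed.

Lemma stage_step n : step_spec (stage n) (nth_form n) (stage (S n)).
Proof. apply stage_spec, stage_consistent. Qed.

Lemma stage_mono n m : n <= m -> incl (stage n) (stage m).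
Proof.
induction 1; [apply incl_refl|].
eapply incl_tran; eauto; apply stage_step.
Qed.

(** The deductive closure of the union of the stages. *)
Definition thy (A : form) : Prop := exists n, proves T (stage n) A.

Lemma thy_proves G A : (forall B, In B G -> thy B) -> proves T G A -> thy A.
Proof.
intro HG.
(* Stages increase, so finitely many hypotheses are all proved at one common stage. *)
assert (HN : exists n, forall B, In B G -> proves T (stage n) B).
{ induction G as [|B G IH]; [exists 0; intros B []|].
  destruct IH as [n Hn]; [intros; apply HG; simpl; auto|].
  destruct (HG B) as [m Hm]; [simpl; auto|].
  exists (n + m); intros C [<-|HC].
  - eapply proves_weaken; [exact Hm|apply stage_mono; lia].
  - eapply proves_weaken; [apply Hn, HC|apply stage_mono; lia]. }
destruct HN as [n Hn]; clear HG; intro HA; exists n.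
(* The hypotheses are cut away one at a time. *)
assert (HG : forall G', (forall B, In B G' -> proves T (stage n) B) -> forall A,
  proves T (G' ++ stage n) A -> proves T (stage n) A).
{ clear; induction G' as [|B G' IH]; simpl; auto; intros HG' A HA.
  apply IH; auto.
  apply proves_cut with B; auto.
  eapply proves_weaken; [apply HG'; auto|apply incl_appr, incl_refl]. }
apply (HG G Hn); eapply proves_weaken; [exact HA|apply incl_appl, incl_refl].
Qed.

Lemma thy_consistent : ~ thy Bot.
Proof. intros [n Hn]; exact (stage_consistent n Hn). Qed.

(** Every formula is decided: [A] is treated at the step numbered by its code. *)
Lemma thy_neg A : thy (Neg A) <-> ~ thy A.
Proof.
split.
- intros HN HA; apply thy_consistent, (thy_proves (Neg A :: A :: nil)).
  + intros B [<-|[<-|[]]]; auto.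
  + apply P_ImpE with A; apply P_Hyp; simpl; auto.
- intro HA; destruct (stage_step (form_code A)) as (_ & _ & H).
  rewrite nth_form_code in H; destruct H as [H|[H _]]; [now exists (S (form_code A))|].
  destruct HA; exists (S (form_code A)); now apply P_Hyp.
Qed.

Lemma thy_imp A B : thy (Imp A B) <-> (thy A -> thy B).
Proof.
split.
- intros HI HA; apply (thy_proves (Imp A B :: A :: nil)).
  + intros C [<-|[<-|[]]]; auto.
  + apply P_ImpE with A; apply P_Hyp; simpl; auto.
- intro H; destruct (classic (thy A)) as [HA|HA].
  + apply (thy_proves (B :: nil)); [intros C [<-|[]]; auto|].
    apply P_ImpI, P_Hyp; simpl; auto.
  + apply thy_neg in HA; apply (thy_proves (Neg A :: nil)); [intros C [<-|[]]; auto|].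
    apply P_ImpI, proves_bot, P_ImpE with A; apply P_Hyp; simpl; auto.
Qed.

(** If [All A] were absent, its negation would be in the theory, and the step treating that negation
    would have added a counterexample [Var z]. *)
Lemma thy_all A : thy (All A) <-> forall t, thy (inst A t).
Proof.
split.
- intros H t; apply (thy_proves (All A :: nil)); [intros C [<-|[]]; auto|].
  apply P_AllE, P_Hyp; simpl; auto.
- intro H; apply NNPP; intro HA; apply thy_neg in HA.
  destruct (stage_step (form_code (Neg (All A)))) as (_ & _ & Hs).
  rewrite nth_form_code in Hs; destruct Hs as [Hs|(_ & Hs & _)].
  + revert HA; apply (thy_neg (Neg (All A))); eexists; eauto.
  + destruct (Hs A eq_refl) as [z Hz].
    apply (thy_neg (inst A (Var z))); auto.
    eexists; apply P_Hyp; exact Hz.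
Qed.

Lemma thy_sall A : thy (SAll A) <-> forall X, thy (sinst A X).
Proof.
split.
- intros H t; apply (thy_proves (SAll A :: nil)); [intros C [<-|[]]; auto|].
  apply P_SAllE, P_Hyp; simpl; auto.
- intro H; apply NNPP; intro HA; apply thy_neg in HA.
  destruct (stage_step (form_code (Neg (SAll A)))) as (_ & _ & Hs).
  rewrite nth_form_code in Hs; destruct Hs as [Hs|(_ & _ & Hs)].
  + revert HA; apply (thy_neg (Neg (SAll A))); eexists; eauto.
  + destruct (Hs A eq_refl) as [z Hz].
    apply (thy_neg (sinst A z)); auto.
    eexists; apply P_Hyp; exact Hz.
Qed.

Lemma thy_eq_refl t : thy (Eq t t).
Proof. exists 0; apply P_EqRefl. Qed.

Lemma thy_eq A t u : thy (Eq t u) -> thy (inst A t) -> thy (inst A u).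
Proof.
intros; apply (thy_proves (Eq t u :: inst A t :: nil)).
- intros C [<-|[<-|[]]]; auto.
- apply P_EqE with t; apply P_Hyp; simpl; auto.
Qed.

(** Numbers are the classes of provably equal terms, given as predicates. *)

Definition cls (t : term) : term -> Prop := fun u => thy (Eq t u).

Definition point : Type := { c : term -> Prop | exists t, c = cls t }.

Definition pt (t : term) : point := exist _ (cls t) (ex_intro _ t eq_refl).

Definition rep (d : point) : term := epsilon (inhabits Zero) (fun t => d = pt t).

Lemma pt_rep d : pt (rep d) = d.
Proof.
symmetry; apply (epsilon_spec (inhabits Zero) (fun t => d = pt t)).
destruct d as [c [t ->]]; now exists t.
Qed.

Lemma inst_tlift t u : tsubst (fun i => match i with 0 => u | S j => Var j end) (tlift t) = t.
Proof. unfold tlift; rewrite tsubst_comp; apply tsubst_Var. Qed.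

Lemma thy_eq_sym t u : thy (Eq t u) -> thy (Eq u t).
Proof.
intro H; generalize (thy_eq (Eq (Var 0) (tlift t)) t u H).
unfold inst; simpl; rewrite !inst_tlift; auto using thy_eq_refl.
Qed.

Lemma thy_eq_trans t u v : thy (Eq t u) -> thy (Eq u v) -> thy (Eq t v).
Proof.
intros H1 H2; generalize (thy_eq (Eq (tlift t) (Var 0)) u v H2).
unfold inst; simpl; rewrite !inst_tlift; auto.
Qed.

Lemma pt_eq t u : pt t = pt u <-> thy (Eq t u).
Proof.
split.
- intros [= H]; change (cls t u); rewrite H; apply thy_eq_refl.
- intro H; apply eq_sig_hprop; [intros; apply proof_irrelevance|].
  simpl; extensionality v; apply propositional_extensionality.
  split; intro; eapply thy_eq_trans; eauto using thy_eq_sym.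
Qed.

Lemma thy_replace A t u : pt t = pt u -> thy (inst A t) <-> thy (inst A u).
Proof. rewrite pt_eq; split; apply thy_eq; auto using thy_eq_sym. Qed.

(** Applied to [Add] and [Mul]. The arguments are replaced one after the other, everything else
    being lifted out of reach of the replaced index 0. *)
Lemma pt_congr (f : term -> term -> term) t t' u u' :
  (forall sg t u, tsubst sg (f t u) = f (tsubst sg t) (tsubst sg u)) ->
  pt t = pt t' -> pt u = pt u' -> pt (f t u) = pt (f t' u').
Proof.
intros Hf Ht Hu; apply pt_eq.
assert (H1 := thy_replace (Eq (f (tlift t) (tlift u)) (f (Var 0) (tlift u))) t t' Ht).
assert (H2 := thy_replace (Eq (f (tlift t) (tlift u)) (f (tlift t') (Var 0))) u u' Hu).
unfold inst in H1, H2; simpl in H1, H2.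
rewrite !Hf, !inst_tlift in H1; rewrite !Hf, !inst_tlift in H2; simpl in H1, H2.
apply H2, H1, thy_eq_refl.
Qed.

(** Numbers are quotiented because [Eq] is read as Rocq equality. Set variables serve as sets
    without a quotient, as the language has no equality between sets. *)
Definition term_model : structure := {|
  num := point;
  zero := pt Zero;
  one := pt One;
  add := fun d e => pt (Add (rep d) (rep e));
  mul := fun d e => pt (Mul (rep d) (rep e));
  less := fun d e => thy (Lt (rep d) (rep e));
  set := nat;
  mem := fun d X => thy (Mem (rep d) X)
|}.

Lemma eval_pt sg t : @eval term_model (fun i => pt (sg i)) t = pt (tsubst sg t).
Proof.
induction t; simpl; auto; rewrite IHt1, IHt2; apply pt_congr; auto using pt_rep.
Qed.

(** The truth lemma, by induction on [A]; it is stated for all substitutions because quantifiers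
    extend the assignment. *)
Lemma truth A sg xi :
  @sat term_model (fun i => pt (sg i)) xi A <-> thy (subst sg xi A).
Proof.
revert sg xi; induction A; intros sg xi; simpl; rewrite ?eval_pt.
- apply pt_eq.
(* The model speaks of the chosen representatives of the classes of [a] and [b], which are exchanged
   for [a] and [b] in turn. *)
- set (a := tsubst sg t); set (b := tsubst sg u).
  generalize (thy_replace (Lt (Var 0) (tlift (rep (pt b)))) _ _ (pt_rep (pt a))).
  generalize (thy_replace (Lt (tlift a) (Var 0)) _ _ (pt_rep (pt b))).
  unfold inst; simpl; rewrite !inst_tlift; tauto.
- apply (thy_replace (Mem (Var 0) (xi X)) _ _ (pt_rep _)).
- split; [intros []|apply thy_consistent].
- now rewrite thy_imp, IHA1, IHA2.
- rewrite thy_all.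
  assert (H : forall t, @sat term_model (scons (pt t) (fun i => pt (sg i))) xi A <->
    thy (inst (subst (up sg) xi A) t)).
  { intro t; replace (inst (subst (up sg) xi A) t) with (subst (scons t sg) xi A).
    - rewrite <- IHA; replace (scons (pt t) (fun i => pt (sg i))) with
        (fun i => pt (scons t sg i)); [reflexivity|].
      extensionality i; now destruct i.
    - unfold inst; rewrite subst_comp; f_equal.
      extensionality i; destruct i; simpl; auto; now rewrite inst_tlift. }
  split; intros HA t; [apply H, HA|].
  (* Every point is the class of a term, so quantifying over points amounts to quantifying over
     terms. *)
  rewrite <- (pt_rep t); apply H, HA.
- rewrite thy_sall.
  assert (H : forall X, @sat term_model (fun i => pt (sg i)) (scons X xi) A <->
    thy (sinst (subst sg (sup xi) A) X)).
  { intro X; rewrite IHA; replace (sinst (subst sg (sup xi) A) X) with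
      (subst sg (scons X xi) A); [reflexivity|].
    unfold sinst; rewrite subst_comp; f_equal.
    - extensionality i; now rewrite tsubst_Var.
    - extensionality i; now destruct i. }
  split; intros HA X; apply H, HA.
Qed.

Lemma term_model_models : models term_model T.
Proof.
intros A HA rho chi.
replace rho with (fun i => pt (rep (rho i))) by (extensionality i; apply pt_rep).
apply truth; exists 0; apply P_Ax, T_subst, HA.
Qed.

Lemma term_model_hyp A : In A G0 -> @sat term_model (fun i => pt (Var i)) (fun X => X) A.
Proof.
intro HA; apply truth; rewrite subst_Var; exists 0; now apply P_Hyp.
Qed.

End Henkin.

(** If [A] is unprovable, [Neg A] alone is consistent by reductio, and its term model is a model of
    [T] in which [A] fails. *)
Theorem completeness A :
  (forall M, models M T -> forall (rho : nat -> num M) chi, sat rho chi A) ->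
  provable T A.
Proof.
intro H; apply P_Raa, NNPP; intro HA.
apply (term_model_hyp (Neg A :: nil) HA (Neg A)); simpl; auto.
now apply H, term_model_models.
Qed.

End Completeness.

(** * Satisfaction under substitution and under the abbreviated connectives *)

Lemma eval_tsubst M (rho : nat -> num M) sg t :
  eval rho (tsubst sg t) = eval (fun i => eval rho (sg i)) t.
Proof. induction t; simpl; congruence. Qed.

Lemma sat_ext M A (rho rho' : nat -> num M) chi chi' :
  (forall i, rho i = rho' i) -> (forall X, chi X = chi' X) ->
  sat rho chi A <-> sat rho' chi' A.
Proof.
intros Hrho Hchi; replace rho' with rho by (extensionality i; auto).
now replace chi' with chi by (extensionality i; auto).
Qed.

Lemma sat_subst M A (rho : nat -> num M) chi sg xi :
  sat rho chi (subst sg xi A) <->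
  sat (fun i => eval rho (sg i)) (fun X => chi (xi X)) A.
Proof.
revert rho chi sg xi; induction A; intros; simpl; rewrite ?eval_tsubst; try tauto.
- now rewrite IHA1, IHA2.
- assert (H : forall d, sat (scons d rho) chi (subst (up sg) xi A) <->
    sat (scons d (fun i => eval rho (sg i))) (fun X => chi (xi X)) A).
  { intro d; rewrite IHA; apply sat_ext; auto; intros [|i]; auto; simpl.
    unfold tlift; now rewrite eval_tsubst. }
  split; intros H' d; apply H, H'.
- assert (H : forall X, sat rho (scons X chi) (subst sg (sup xi) A) <->
    sat (fun i => eval rho (sg i)) (scons X (fun Y => chi (xi Y))) A).
  { intro X; rewrite IHA; apply sat_ext; auto; intros [|i]; auto. }
  split; intros H' X; apply H, H'.
Qed.

Section Reflection.

Context {M : structure} (rho : nat -> num M) (chi : nat -> set M).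

Lemma sat_Imp A B p q : (sat rho chi A <-> p) -> (sat rho chi B <-> q) ->
  (sat rho chi (Imp A B) <-> (p -> q)).
Proof. simpl; tauto. Qed.

Lemma sat_Neg A p : (sat rho chi A <-> p) -> (sat rho chi (Neg A) <-> ~ p).
Proof. simpl; tauto. Qed.

Lemma sat_And A B p q : (sat rho chi A <-> p) -> (sat rho chi B <-> q) ->
  (sat rho chi (And A B) <-> p /\ q).
Proof. simpl; intros <- <-; split; [intro; apply NNPP|]; tauto. Qed.

Lemma sat_Or A B p q : (sat rho chi A <-> p) -> (sat rho chi B <-> q) ->
  (sat rho chi (Or A B) <-> p \/ q).
Proof. simpl; intros <- <-; destruct (classic (sat rho chi A)); tauto. Qed.

Lemma sat_Iff A B p q : (sat rho chi A <-> p) -> (sat rho chi B <-> q) ->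
  (sat rho chi (Iff A B) <-> (p <-> q)).
Proof. intros HA HB; unfold Iff; apply sat_And; now apply sat_Imp. Qed.

Lemma sat_All A p : (forall d, sat (scons d rho) chi A <-> p d) ->
  (sat rho chi (All A) <-> forall d, p d).
Proof. intro H; simpl; split; intros H' d; apply H, H'. Qed.

Lemma sat_Ex A p : (forall d, sat (scons d rho) chi A <-> p d) ->
  (sat rho chi (Ex A) <-> exists d, p d).
Proof.
intro H; simpl; split.
- intro H'; apply NNPP; intro Hp; apply H'; intros d Hd; apply Hp; exists d.
  now apply H.
- intros [d Hd] H'; apply (H' d), H, Hd.
Qed.

Lemma sat_SAll A p : (forall X, sat rho (scons X chi) A <-> p X) ->
  (sat rho chi (SAll A) <-> forall X, p X).
Proof. intro H; simpl; split; intros H' X; apply H, H'. Qed.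

Lemma sat_SEx A p : (forall X, sat rho (scons X chi) A <-> p X) ->
  (sat rho chi (SEx A) <-> exists X, p X).
Proof.
intro H; simpl; split.
- intro H'; apply NNPP; intro Hp; apply H'; intros X HX; apply Hp; exists X.
  now apply H.
- intros [X HX] H'; apply (H' X), H, HX.
Qed.

End Reflection.

(** The abbreviations are matched by name, so that [And] becomes a Rocq conjunction instead of
    unfolding into [Imp] and [Bot]. *)
Ltac reflect :=
  repeat lazymatch goal with
  | |- sat _ _ (And _ _) <-> _ => apply sat_And
  | |- sat _ _ (Or _ _) <-> _ => apply sat_Or
  | |- sat _ _ (Iff _ _) <-> _ => apply sat_Iff
  | |- sat _ _ (Neg _) <-> _ => apply sat_Neg
  | |- sat _ _ (Ex _) <-> _ => apply sat_Ex; intro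
  | |- sat _ _ (SEx _) <-> _ => apply sat_SEx; intro
  | |- sat _ _ (All _) <-> _ => apply sat_All; intro
  | |- sat _ _ (SAll _) <-> _ => apply sat_SAll; intro
  | |- sat _ _ (Imp _ _) <-> _ => apply sat_Imp
  | |- sat _ _ _ <-> _ => reflexivity
  end.

(** * Arithmetic in a model *)

Section Arithmetic.

(** Satisfaction needs an assignment of sets even for purely arithmetical formulas, and a structure
    may have an empty set sort; [X0] supplies the assignment [chi0]. *)
Context {M : structure} (M_RCA0 : models M RCA0) (X0 : set M).

Let rho0 : nat -> num M := fun _ => zero.
Let chi0 : nat -> set M := fun _ => X0.

Lemma sigma_ind A rho chi : Sigma01 A ->
  @sat M (scons zero rho) chi A ->
  (forall d, sat (scons d rho) chi A -> sat (scons (add d one) rho) chi A) ->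
  forall d, sat (scons d rho) chi A.
Proof.
intros HA H0 HS.
assert (HI : sat rho chi (induction_axiom A)) by now apply M_RCA0, Sigma01_induction.
apply HI, (sat_And rho chi _ _ _ _ (iff_refl _) (iff_refl _)); split.
- apply sat_subst; eapply sat_ext; [| |exact H0]; auto; now intros [|i].
- intros d Hd; apply sat_subst; eapply sat_ext; [| |exact (HS d Hd)]; auto.
  now intros [|i].
Qed.

Lemma sat_lift A d (rho : nat -> num M) chi :
  sat (scons d rho) chi (lift A) <-> sat rho chi A.
Proof. apply sat_subst. Qed.

(** A vacuous existential quantifier turns [A] into a [Sigma01] formula. *)
Lemma delta_ind A rho chi : Delta00 A ->
  @sat M (scons zero rho) chi A ->
  (forall d, sat (scons d rho) chi A -> sat (scons (add d one) rho) chi A) ->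
  forall d, sat (scons d rho) chi A.
Proof.
intros HA H0 HS.
assert (HE : forall d, sat (scons d rho) chi (Ex (lift A)) <-> sat (scons d rho) chi A).
{ intro d; transitivity (exists e : num M, sat (scons d rho) chi A).
  - apply sat_Ex; intro e; apply sat_lift.
  - split; [intros [_ H]; exact H|intro H; now exists zero]. }
intro d; apply HE; revert d; apply sigma_ind.
- constructor; now apply Delta00_subst.
- now apply HE.
- intros d Hd; apply HE, HS, HE, Hd.
Qed.

Lemma comprehension A B rho chi : Sigma01 A -> Pi01 B ->
  (forall n, @sat M (scons n rho) chi A <-> sat (scons n rho) chi B) ->
  exists X, forall n, mem n X <-> sat (scons n rho) chi A.
Proof.
intros HA HB HAB.
assert (HC : sat rho chi (comprehension_axiom A B))
  by now apply M_RCA0, Delta01_comprehension.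
assert (HX : sat rho chi (comprehension_axiom A B) <->
  ((forall n, sat (scons n rho) chi A <-> sat (scons n rho) chi B) ->
   exists X, forall n, mem n X <-> sat (scons n rho) chi A)).
{ unfold comprehension_axiom; reflect; exact (sat_subst M A _ (scons X chi) Var S). }
now apply HX.
Qed.

Lemma succ_neq_zero (x : num M) : add x one <> zero.
Proof. exact (M_RCA0 _ (succ_neq0 (Var 0)) (fun _ => x) chi0). Qed.

Lemma add_one_inj (x y : num M) : add x one = add y one -> x = y.
Proof. exact (M_RCA0 _ (succ_inj (Var 0) (Var 1)) (scons x (fun _ => y)) chi0). Qed.

Lemma add_zero_r (x : num M) : add x zero = x.
Proof. exact (M_RCA0 _ (add_0 (Var 0)) (fun _ => x) chi0). Qed.

Lemma add_succ_r (x y : num M) : add x (add y one) = add (add x y) one.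
Proof. exact (M_RCA0 _ (add_succ (Var 0) (Var 1)) (scons x (fun _ => y)) chi0). Qed.

Lemma mul_zero_r (x : num M) : mul x zero = zero.
Proof. exact (M_RCA0 _ (mul_0 (Var 0)) (fun _ => x) chi0). Qed.

Lemma mul_succ_r (x y : num M) : mul x (add y one) = add (mul x y) x.
Proof. exact (M_RCA0 _ (mul_succ (Var 0) (Var 1)) (scons x (fun _ => y)) chi0). Qed.

Lemma not_less_zero (x : num M) : ~ less x zero.
Proof. exact (M_RCA0 _ (nlt_0 (Var 0)) (fun _ => x) chi0). Qed.

Lemma less_succ (x y : num M) : less x (add y one) <-> less x y \/ x = y.
Proof.
set (rho := scons x (fun _ : nat => y)).
set (A := Iff (Lt (Var 0) (Add (Var 1) One)) (Or (Lt (Var 0) (Var 1)) (Eq (Var 0) (Var 1)))).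
assert (HA : sat rho chi0 A <-> (less x (add y one) <-> less x y \/ x = y))
  by (unfold A; reflect).
apply HA, M_RCA0, lt_succ.
Qed.

Lemma add_assoc (x y z : num M) : add x (add y z) = add (add x y) z.
Proof.
(* Here and below index 0 is the induction variable, and higher indices are parameters. *)
refine (delta_ind
  (Eq (Add (Var 1) (Add (Var 2) (Var 0))) (Add (Add (Var 1) (Var 2)) (Var 0)))
  (scons x (scons y rho0)) chi0 _ _ _ z); [constructor|simpl..].
- now rewrite !add_zero_r.
- intros d H; now rewrite !add_succ_r, H.
Qed.

Lemma add_zero_l (x : num M) : add zero x = x.
Proof.
refine (delta_ind (Eq (Add Zero (Var 0)) (Var 0)) rho0 chi0 _ _ _ x);
  [constructor|simpl..].
- apply add_zero_r.
- intros d H; now rewrite !add_succ_r, H.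
Qed.

Lemma add_succ_l (x y : num M) : add (add x one) y = add (add x y) one.
Proof.
refine (delta_ind
  (Eq (Add (Add (Var 1) One) (Var 0)) (Add (Add (Var 1) (Var 0)) One))
  (scons x rho0) chi0 _ _ _ y); [constructor|simpl..].
- now rewrite !add_zero_r.
- intros d H; now rewrite !add_succ_r, H.
Qed.

Lemma add_comm (x y : num M) : add x y = add y x.
Proof.
refine (delta_ind (Eq (Add (Var 1) (Var 0)) (Add (Var 0) (Var 1)))
  (scons x rho0) chi0 _ _ _ y); [constructor|simpl..].
- now rewrite add_zero_r, add_zero_l.
- intros d H; now rewrite add_succ_r, add_succ_l, H.
Qed.

Lemma mul_zero_l (x : num M) : mul zero x = zero.
Proof.
refine (delta_ind (Eq (Mul Zero (Var 0)) Zero) rho0 chi0 _ _ _ x);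
  [constructor|simpl..].
- apply mul_zero_r.
- intros d H; now rewrite mul_succ_r, H, add_zero_r.
Qed.

Lemma mul_succ_l (x y : num M) : mul (add x one) y = add (mul x y) y.
Proof.
refine (delta_ind
  (Eq (Mul (Add (Var 1) One) (Var 0)) (Add (Mul (Var 1) (Var 0)) (Var 0)))
  (scons x rho0) chi0 _ _ _ y); [constructor|simpl..].
- now rewrite !mul_zero_r, add_zero_r.
- intros d H; rewrite !mul_succ_r, H, !add_succ_r; f_equal.
  now rewrite <- !add_assoc, (add_comm d x).
Qed.

Lemma mul_comm (x y : num M) : mul x y = mul y x.
Proof.
refine (delta_ind (Eq (Mul (Var 1) (Var 0)) (Mul (Var 0) (Var 1)))
  (scons x rho0) chi0 _ _ _ y); [constructor|simpl..].
- now rewrite mul_zero_r, mul_zero_l.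
- intros d H; now rewrite mul_succ_r, mul_succ_l, H.
Qed.

Lemma mul_add_r (x y z : num M) : mul x (add y z) = add (mul x y) (mul x z).
Proof.
refine (delta_ind
  (Eq (Mul (Var 1) (Add (Var 2) (Var 0)))
      (Add (Mul (Var 1) (Var 2)) (Mul (Var 1) (Var 0))))
  (scons x (scons y rho0)) chi0 _ _ _ z); [constructor|simpl..].
- now rewrite mul_zero_r, !add_zero_r.
- intros d H; now rewrite add_succ_r, !mul_succ_r, H, add_assoc.
Qed.

Lemma mul_assoc (x y z : num M) : mul x (mul y z) = mul (mul x y) z.
Proof.
refine (delta_ind
  (Eq (Mul (Var 1) (Mul (Var 2) (Var 0))) (Mul (Mul (Var 1) (Var 2)) (Var 0)))
  (scons x (scons y rho0)) chi0 _ _ _ z); [constructor|simpl..].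
- now rewrite !mul_zero_r.
- intros d H; now rewrite !mul_succ_r, mul_add_r, H.
Qed.

Lemma one_mul (x : num M) : mul one x = x.
Proof. now rewrite <- (add_zero_l one), mul_succ_l, mul_zero_l, add_zero_l. Qed.

Lemma num_semi_ring : semi_ring_theory (@zero M) one add mul eq.
Proof.
constructor; auto using add_zero_l, add_comm, add_assoc, one_mul, mul_zero_l,
  mul_comm, mul_assoc.
intros; now rewrite mul_comm, mul_add_r, !(mul_comm p).
Qed.

Add Ring num_ring : num_semi_ring.

Lemma add_cancel_r (x y z : num M) : add x z = add y z -> x = y.
Proof.
refine (delta_ind
  (Imp (Eq (Add (Var 1) (Var 0)) (Add (Var 2) (Var 0))) (Eq (Var 1) (Var 2)))
  (scons x (scons y rho0)) chi0 _ _ _ z); [repeat constructor|simpl..].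
- now rewrite !add_zero_r.
- intros d H; rewrite !add_succ_r; intro H'; now apply H, add_one_inj.
Qed.

Lemma zero_or_succ (x : num M) : x = zero \/ exists y, x = add y one.
Proof.
(* The quantifier stands in front of the disjunction to make the formula [Sigma01]. *)
set (A := Ex (Or (Eq (Var 1) Zero) (Eq (Var 1) (Add (Var 0) One)))).
assert (HA : forall d, sat (scons d rho0) chi0 A <->
  exists y, d = zero \/ d = add y one) by (intro; unfold A; reflect).
assert (H : exists y, x = zero \/ x = add y one).
{ apply HA, sigma_ind.
  - repeat constructor.
  - apply HA; exists zero; auto.
  - intros d _; apply HA; exists d; auto. }
destruct H as [y [H|H]]; eauto.
Qed.

Lemma less_iff (x y : num M) : less x y <-> exists z, y = add x (add z one).
Proof.
split.
(* Pulling the quantifier out of the implication again keeps the induction [Sigma01]. *)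
- set (A := Ex (Imp (Lt (Var 2) (Var 1)) (Eq (Var 1) (Add (Var 2) (Add (Var 0) One))))).
  assert (HA : forall d, sat (scons d (scons x rho0)) chi0 A <->
    exists z, less x d -> d = add x (add z one)) by (intro; unfold A; reflect).
  assert (H : exists z, less x y -> y = add x (add z one)).
  { apply HA, sigma_ind.
    - repeat constructor.
    - apply HA; exists zero; intro H; now apply not_less_zero in H.
    - intros d Hd; apply HA in Hd; apply HA; destruct Hd as [z Hz].
      destruct (classic (less x d)) as [Hd|Hd].
      + exists (add z one); intros _; rewrite (Hz Hd) at 1; ring.
      + exists zero; intro H; apply less_succ in H; destruct H as [H| ->]; [tauto|ring]. }
  destruct H as [z Hz]; eauto.
- intros [z ->]; revert z.
  refine (delta_ind (Lt (Var 1) (Add (Var 1) (Add (Var 0) One)))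
    (scons x rho0) chi0 _ _ _); [constructor|simpl..].
  + rewrite add_zero_l; apply less_succ; auto.
  + intros d H; rewrite add_succ_r; apply less_succ; auto.
Qed.

Lemma trichotomy (x y : num M) : less x y \/ x = y \/ less y x.
Proof.
set (A := Or (Lt (Var 1) (Var 0)) (Or (Eq (Var 1) (Var 0)) (Lt (Var 0) (Var 1)))).
assert (HA : forall d, sat (scons d (scons x rho0)) chi0 A <->
  less x d \/ x = d \/ less d x) by (intro; unfold A; reflect).
apply HA, delta_ind.
- repeat constructor.
- apply HA; destruct (zero_or_succ x) as [H|[z ->]]; auto.
  right; right; apply less_iff; exists z; ring.
- intros d Hd; apply HA in Hd; apply HA; rewrite less_succ.
  destruct Hd as [H|[H|H]]; auto.
  apply less_iff in H; destruct H as [z ->].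
  (* With [x = d + (z + 1)], the successor of [d] reaches [x] exactly when [z] is zero. *)
  destruct (zero_or_succ z) as [->|[w ->]].
  + right; left; ring.
  + right; right; apply less_iff; exists w; ring.
Qed.

Lemma add_succ_neq (x y : num M) : x <> add x (add y one).
Proof.
intro H; apply (succ_neq_zero y), (add_cancel_r _ _ x); rewrite H at 2; ring.
Qed.

(** * The pairing function *)

Definition pair (x y : num M) : num M := add (mul (add x y) (add x y)) x.

Lemma pair_less (x y x' y' : num M) :
  less (add x y) (add x' y') -> pair x y <> pair x' y'.
Proof.
intros Hs H; apply less_iff in Hs; destruct Hs as [z Hz].
unfold pair in H; rewrite Hz in H.
(* With [s = x + y] and [x' + y' = s + z + 1], subtracting [s^2 + x] from [(s + z + 1)^2 + x']
   leaves [(x + 2y) + 2sz + (z + 1)z + z + x' + 1], a successor. *)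
apply (add_succ_neq (add (mul (add x y) (add x y)) x)
  (add (add (add x (add y y)) (add (mul (add (add x y) (add x y)) z)
    (mul (add z one) z))) (add z x'))).
rewrite H at 1; ring.
Qed.

Lemma pair_inj (x y x' y' : num M) : pair x y = pair x' y' -> x = x' /\ y = y'.
Proof.
intro H; destruct (trichotomy (add x y) (add x' y')) as [Hs|[Hs|Hs]].
- now apply pair_less in Hs.
- assert (Hx : x = x').
  { unfold pair in H; rewrite Hs in H.
    apply add_cancel_r with (mul (add x' y') (add x' y')).
    now rewrite add_comm, H, add_comm. }
  split; auto; subst x'; apply add_cancel_r with x.
  now rewrite add_comm, Hs, add_comm.
- symmetry in H; now apply pair_less in Hs.
Qed.

(** Lets a number [n] be decoded by quantifiers bounded by [n + 1]. The square of [s = x + y] is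
    [z + s] for some [z], hence the code is large enough. *)
Lemma less_succ_pair (x y : num M) :
  less x (add (pair x y) one) /\ less y (add (pair x y) one).
Proof.
assert (H : exists z, mul (add x y) (add x y) = add z (add x y)).
{ destruct (zero_or_succ (add x y)) as [->|[z ->]].
  - exists zero; ring.
  - exists (mul z (add z one)); ring. }
destruct H as [z Hz]; unfold pair; rewrite Hz; split; apply less_iff.
- exists (add z (add x y)); ring.
- exists (add z (add x x)); ring.
Qed.

(** Lets one unbounded quantifier stand for four, since [Sigma01] and [Pi01] admit only one in
    front. *)
Lemma common_bound (x y z w : num M) :
  exists b, less x b /\ less y b /\ less z b /\ less w b.
Proof.
exists (add (add (add x y) (add z w)) one); repeat split; apply less_iff.
- exists (add y (add z w)); ring.
- exists (add x (add z w)); ring.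
- exists (add x (add y w)); ring.
- exists (add x (add y z)); ring.
Qed.

End Arithmetic.

(** * The definitions of the orders, read in a structure *)

Section Orders.

Context {M : structure}.
Implicit Types P R L S F A B f g : set M.

Definition m_sub_prod R A B : Prop :=
  forall n, mem n R -> exists x y, mem x A /\ mem y B /\ n = pair x y.

Definition m_le R x y : Prop := mem (pair x y) R.
Definition m_lt R x y : Prop := m_le R x y /\ x <> y.

Definition m_partial_order P R : Prop :=
  m_sub_prod R P P
  /\ (forall x, mem x P -> m_le R x x)
  /\ (forall x y z, mem x P -> mem y P -> mem z P ->
        m_le R x y -> m_le R y z -> m_le R x z)
  /\ (forall x y, mem x P -> mem y P -> m_le R x y -> m_le R y x -> x = y).

Definition m_linear_order L S : Prop :=
  m_partial_order L S
  /\ (forall x y, mem x L -> mem y L -> m_le S x y \/ m_le S y x).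

Definition m_func f A B : Prop :=
  m_sub_prod f A B
  /\ (forall x, mem x A -> exists y, mem (pair x y) f
        /\ (forall z, mem (pair x z) f -> z = y)).

Definition m_values f p g q (Q : num M -> num M -> Prop) : Prop :=
  exists x y, mem (pair p x) f /\ mem (pair q y) g /\ Q x y.

Definition m_i1 P L S F : Prop :=
  forall p, mem p P ->
    (exists x, mem (pair p x) F)
    /\ (forall x y z, mem (pair p x) F -> mem (pair p y) F -> mem z L ->
         m_le S x z -> m_le S z y -> mem (pair p z) F).

Definition m_i2 P R S F : Prop :=
  forall p q, mem p P -> mem q P ->
    (m_lt R p q <->
     (forall x y, mem (pair p x) F -> mem (pair q y) F -> m_lt S x y)).

Definition m_sub_section F p q : Prop :=
  forall x, mem (pair p x) F -> mem (pair q x) F.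

Definition m_eq_section F p q : Prop :=
  forall x, mem (pair p x) F <-> mem (pair q x) F.

Definition m_i3 P F : Prop :=
  forall p q, mem p P -> mem q P -> p <> q -> ~ m_eq_section F p q.

Definition m_i4 P F : Prop :=
  forall p q, mem p P -> mem q P -> m_sub_section F p q -> m_eq_section F p q.

Definition m_interval_order P R : Prop :=
  exists L S F, m_linear_order L S /\ m_sub_prod F P L
    /\ m_i1 P L S F /\ m_i2 P R S F.

Definition m_one_one_interval_order P R : Prop :=
  exists L S F, m_linear_order L S /\ m_sub_prod F P L
    /\ m_i1 P L S F /\ m_i2 P R S F /\ m_i3 P F.

Definition m_proper_interval_order P R : Prop :=
  exists L S F, m_linear_order L S /\ m_sub_prod F P L
    /\ m_i1 P L S F /\ m_i2 P R S F /\ m_i4 P F.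

Definition m_proper_one_one_interval_order P R : Prop :=
  exists L S F, m_linear_order L S /\ m_sub_prod F P L
    /\ m_i1 P L S F /\ m_i2 P R S F /\ m_i3 P F /\ m_i4 P F.

Definition m_c1 P S f0 f1 : Prop :=
  forall p, mem p P -> m_values f0 p f1 p (m_le S).

Definition m_c2 P R S f0 f1 : Prop :=
  forall p q, mem p P -> mem q P -> (m_lt R p q <-> m_values f1 p f0 q (m_lt S)).

Definition m_value_neq f p g q : Prop := m_values f p g q (fun x y => x <> y).

Definition m_c3 P f0 f1 : Prop :=
  forall p q, mem p P -> mem q P -> p <> q ->
    m_value_neq f0 p f0 q \/ m_value_neq f1 p f1 q.

Definition m_c4 P f0 f1 : Prop :=
  forall p q, mem p P -> mem q P ->
    (p <> q -> m_value_neq f0 p f0 q)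
    /\ (p <> q -> m_value_neq f1 p f1 q)
    /\ m_value_neq f0 p f1 q
    /\ m_value_neq f1 p f0 q.

Definition m_c5 P S f0 f1 : Prop :=
  forall p q, mem p P -> mem q P ->
    (m_values f0 p f0 q (m_lt S) <-> m_values f1 p f1 q (m_lt S)).

Definition m_closed_interval_order P R : Prop :=
  exists L S f0 f1, m_linear_order L S /\ m_func f0 P L /\ m_func f1 P L
    /\ m_c1 P S f0 f1 /\ m_c2 P R S f0 f1.

Definition m_one_one_closed_interval_order P R : Prop :=
  exists L S f0 f1, m_linear_order L S /\ m_func f0 P L /\ m_func f1 P L
    /\ m_c1 P S f0 f1 /\ m_c2 P R S f0 f1 /\ m_c3 P f0 f1.

Definition m_distinguishing_interval_order P R : Prop :=
  exists L S f0 f1, m_linear_order L S /\ m_func f0 P L /\ m_func f1 P L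
    /\ m_c1 P S f0 f1 /\ m_c2 P R S f0 f1 /\ m_c4 P f0 f1.

Definition m_proper_closed_interval_order P R : Prop :=
  exists L S f0 f1, m_linear_order L S /\ m_func f0 P L /\ m_func f1 P L
    /\ m_c1 P S f0 f1 /\ m_c2 P R S f0 f1 /\ m_c5 P S f0 f1.

Definition m_proper_one_one_closed_interval_order P R : Prop :=
  exists L S f0 f1, m_linear_order L S /\ m_func f0 P L /\ m_func f1 P L
    /\ m_c1 P S f0 f1 /\ m_c2 P R S f0 f1 /\ m_c3 P f0 f1 /\ m_c5 P S f0 f1.

Definition m_proper_distinguishing_interval_order P R : Prop :=
  exists L S f0 f1, m_linear_order L S /\ m_func f0 P L /\ m_func f1 P L
    /\ m_c1 P S f0 f1 /\ m_c2 P R S f0 f1 /\ m_c4 P f0 f1 /\ m_c5 P S f0 f1.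

Definition m_no_two_plus_two P R : Prop :=
  forall p0 q0 p1 q1, mem p0 P -> mem q0 P -> mem p1 P -> mem q1 P ->
    m_lt R p0 q0 -> m_lt R p1 q1 -> m_le R p0 q1 \/ m_le R p1 q0.

Definition m_no_three_plus_one P R : Prop :=
  forall p0 p1 p2 q, mem p0 P -> mem p1 P -> mem p2 P -> mem q P ->
    m_lt R p0 p1 -> m_lt R p1 p2 -> m_le R p0 q \/ m_le R q p2.

End Orders.

(** [P] and [R] are the set indices 1 and 0, as below the two quantifiers of
    [every]. *)
Definition denotes (A : sexp -> sexp -> fexp)
    (A' : forall M : structure, set M -> set M -> Prop) : Prop :=
  forall M (rho : nat -> num M) chi P R,
    sat rho (scons R (scons P chi)) (A (fun k => k - 1) (fun k => k - 2) 0 2) <->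
    A' M P R.

(** [cbv] computes the indices of the [fexp] encoding but keeps the abbreviations folded, so that
    [reflect] still recognises them. *)
Ltac denotes_tac :=
  intros ? ? ? ? ?; cbv -[sat scons And Or Iff Neg Ex SEx iff not]; reflect.

Lemma denotes_partial_order : denotes partial_order (@m_partial_order).
Proof. denotes_tac. Qed.

Lemma denotes_interval_order : denotes interval_order (@m_interval_order).
Proof. denotes_tac. Qed.

Lemma denotes_proper_interval_order :
  denotes proper_interval_order
    (@m_proper_interval_order).
Proof. denotes_tac. Qed.

Lemma denotes_one_one_interval_order :
  denotes one_one_interval_order
    (@m_one_one_interval_order).
Proof. denotes_tac. Qed.

Lemma denotes_proper_one_one_interval_order :
  denotes proper_one_one_interval_order
    (@m_proper_one_one_interval_order).
Proof. denotes_tac. Qed.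

Lemma denotes_closed_interval_order :
  denotes closed_interval_order
    (@m_closed_interval_order).
Proof. denotes_tac. Qed.

Lemma denotes_proper_closed_interval_order :
  denotes proper_closed_interval_order
    (@m_proper_closed_interval_order).
Proof. denotes_tac. Qed.

Lemma denotes_one_one_closed_interval_order :
  denotes one_one_closed_interval_order
    (@m_one_one_closed_interval_order).
Proof. denotes_tac. Qed.

Lemma denotes_proper_one_one_closed_interval_order :
  denotes proper_one_one_closed_interval_order
    (@m_proper_one_one_closed_interval_order).
Proof. denotes_tac. Qed.

Lemma denotes_distinguishing_interval_order :
  denotes distinguishing_interval_order
    (@m_distinguishing_interval_order).
Proof. denotes_tac. Qed.

Lemma denotes_proper_distinguishing_interval_order :
  denotes proper_distinguishing_interval_order
    (@m_proper_distinguishing_interval_order).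
Proof. denotes_tac. Qed.

Lemma denotes_no_two_plus_two : denotes no_two_plus_two (@m_no_two_plus_two).
Proof. denotes_tac. Qed.

Lemma denotes_no_three_plus_one :
  denotes no_three_plus_one
    (@m_no_three_plus_one).
Proof. denotes_tac. Qed.

(** The bridge from the calculus to models: completeness applies because [RCA0] is closed under
    substitution. *)
Lemma every_provable A A' B B' : denotes A A' -> denotes B B' ->
  (forall M, models M RCA0 -> forall P R : set M,
    m_partial_order P R -> A' M P R -> B' M P R) ->
  provable RCA0 (every A B).
Proof.
intros HA HB H; apply completeness; [intros; now apply RCA0_subst|].
intros M HM rho chi P R HPR HAPR; apply HB, H; auto.
- now apply denotes_partial_order with (rho := rho) (chi := chi).
- now apply HA with (rho := rho) (chi := chi).
Qed.

(** * Interval orders in a model *)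

Section IntervalOrders.

Context {M : structure} (M_RCA0 : models M RCA0).
Implicit Types P R L S F f g : set M.

Lemma sub_prod_pair R A B x y :
  m_sub_prod R A B -> mem (pair x y) R -> mem x A /\ mem y B.
Proof.
intros HR Hxy; destruct (HR _ Hxy) as (x' & y' & Hx & Hy & E).
apply (pair_inj M_RCA0 R) in E; destruct E; now subst.
Qed.

Section LinearOrder.

Context (L S : set M) (HL : m_linear_order L S).

Lemma le_mem x y : m_le S x y -> mem x L /\ mem y L.
Proof. apply sub_prod_pair, HL. Qed.

Lemma le_refl x : mem x L -> m_le S x x.
Proof. apply HL. Qed.

Lemma le_trans x y z : m_le S x y -> m_le S y z -> m_le S x z.
Proof.
intros Hxy Hyz; destruct (le_mem x y Hxy), (le_mem y z Hyz).
now apply (proj1 (proj2 (proj2 (proj1 HL)))) with y.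
Qed.

Lemma le_antisym x y : m_le S x y -> m_le S y x -> x = y.
Proof.
intros Hxy; destruct (le_mem x y Hxy).
now apply (proj2 (proj2 (proj2 (proj1 HL)))).
Qed.

Lemma lt_irrefl x : ~ m_lt S x x.
Proof. now intros [_ H]. Qed.

Lemma lt_not_le x y : m_lt S x y -> ~ m_le S y x.
Proof. intros [Hxy Hne] Hyx; apply Hne; now apply le_antisym. Qed.

Lemma not_lt_le x y : mem x L -> mem y L -> ~ m_lt S x y -> m_le S y x.
Proof.
intros Hx Hy H; destruct (proj2 HL x y Hx Hy) as [Hxy|]; auto.
destruct (classic (x = y)) as [->|Hne]; [now apply le_refl|].
destruct H; now split.
Qed.

Lemma lt_le_trans x y z : m_lt S x y -> m_le S y z -> m_lt S x z.
Proof.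
intros Hxy Hyz; split; [now apply le_trans with y; [apply Hxy|]|].
intros ->; exact (lt_not_le _ _ Hxy Hyz).
Qed.

Lemma le_lt_trans x y z : m_le S x y -> m_lt S y z -> m_lt S x z.
Proof.
intros Hxy Hyz; split; [now apply le_trans with y; [|apply Hyz]|].
intros ->; exact (lt_not_le _ _ Hyz Hxy).
Qed.

End LinearOrder.

Lemma func_value f A B x : m_func f A B -> mem x A -> exists y, mem (pair x y) f.
Proof. intros Hf Hx; destruct (proj2 Hf x Hx) as (y & Hy & _); eauto. Qed.

Lemma func_unique f A B x y z :
  m_func f A B -> mem (pair x y) f -> mem (pair x z) f -> y = z.
Proof.
intros Hf Hy Hz; destruct (sub_prod_pair _ _ _ _ _ (proj1 Hf) Hy) as [Hx _].
destruct (proj2 Hf x Hx) as (w & _ & Hw); now rewrite (Hw y Hy), (Hw z Hz).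
Qed.

Lemma values_iff f g A B p q x y Q : m_func f A B -> m_func g A B ->
  mem (pair p x) f -> mem (pair q y) g -> m_values f p g q Q <-> Q x y.
Proof.
intros Hf Hg Hx Hy; split; [|intro; now exists x, y].
intros (x' & y' & Hx' & Hy' & H).
now rewrite (func_unique _ _ _ _ _ _ Hf Hx Hx'), (func_unique _ _ _ _ _ _ Hg Hy Hy').
Qed.

(** * Closed intervals by comprehension *)

Definition e_less (x y : nexp) : fexp := fun m _ => Lt (x m) (y m).
Definition e_succ (x : nexp) : nexp := fun m => Add (x m) One.

(** The number variable [n] is index 0 at depth 1; [P], [L], [S], [f0], [f1] are
    the set indices 0, ..., 4. All further number quantifiers are bounded by [w],
    or by [n + 1] for the components of the pair [n]. *)
Definition interval_sigma : form :=
  (let n : nexp := fun d => Var (d - 1) in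
   let L : sexp := fun _ => 1 in let S : sexp := fun _ => 2 in
   let f0 : sexp := fun _ => 3 in let f1 : sexp := fun _ => 4 in
   (∃ w, ∃ p, e_less p w ∧ ∃ x, e_less x w ∧ ∃ a, e_less a w ∧ ∃ b, e_less b w ∧
    n ≐ ⟨p, x⟩ ∧ ⟨p, a⟩ ∈ f0 ∧ ⟨p, b⟩ ∈ f1 ∧ le S a x ∧ le S x b))%F 1 0.

(** The universal counterpart tests all endpoints below [w]. The conjunct [p ∈ P] ensures that
    endpoints exist, so that the test is not vacuous for every [w]. *)
Definition interval_pi : form :=
  (let n : nexp := fun d => Var (d - 1) in
   let P : sexp := fun _ => 0 in
   let L : sexp := fun _ => 1 in let S : sexp := fun _ => 2 in
   let f0 : sexp := fun _ => 3 in let f1 : sexp := fun _ => 4 in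
   (∀ w, ∃ p, e_less p (e_succ n) ∧ ∃ x, e_less x (e_succ n) ∧
    n ≐ ⟨p, x⟩ ∧ p ∈ P ∧
    (∀ a, e_less a w → ∀ b, e_less b w →
     ⟨p, a⟩ ∈ f0 → ⟨p, b⟩ ∈ f1 → le S a x ∧ le S x b)))%F 1 0.

Lemma Delta00_And A B : Delta00 A -> Delta00 B -> Delta00 (And A B).
Proof. intros; repeat (apply D_Imp; auto); constructor. Qed.

Lemma interval_sigma_Sigma01 : Sigma01 interval_sigma.
Proof.
(* Prescribing a variable as the bound lets unification see the bound as a [tlift]. *)
constructor; repeat apply (D_ExLt (Var _)); repeat constructor.
Qed.

Lemma interval_pi_Pi01 : Pi01 interval_pi.
Proof.
constructor; do 2 apply (D_ExLt (Add (Var _) One)).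
apply Delta00_And; [repeat constructor|].
apply Delta00_And; [repeat constructor|].
do 2 apply (D_AllLt (Var _)); repeat constructor.
Qed.

Lemma closed_intervals_exist P L S f0 f1 :
  m_linear_order L S -> m_func f0 P L -> m_func f1 P L ->
  exists F, m_sub_prod F P L /\ forall p x, mem (pair p x) F <->
    exists a b, mem (pair p a) f0 /\ mem (pair p b) f1 /\ m_le S a x /\ m_le S x b.
Proof.
intros HL H0 H1.
(* The order matches the set indices 0 to 4; [f1] also fills all later ones. *)
set (chi := scons P (scons L (scons S (scons f0 (fun _ => f1))))).
set (rho := fun _ : nat => @zero M).
assert (HA : forall n, sat (scons n rho) chi interval_sigma <->
  exists w p, less p w /\ exists x, less x w /\ exists a, less a w /\
    exists b, less b w /\ n = pair p x /\
    mem (pair p a) f0 /\ mem (pair p b) f1 /\ m_le S a x /\ m_le S x b).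
{ intro n; cbv -[sat And Or Iff Neg Ex SEx iff not scons]; reflect. }
assert (HB : forall n, sat (scons n rho) chi interval_pi <->
  forall w, exists p, less p (add n one) /\ exists x, less x (add n one) /\
    n = pair p x /\ mem p P /\
    forall a, less a w -> forall b, less b w ->
    mem (pair p a) f0 -> mem (pair p b) f1 -> m_le S a x /\ m_le S x b).
{ intro n; cbv -[sat And Or Iff Neg Ex SEx iff not scons]; reflect. }
destruct (comprehension M_RCA0 interval_sigma interval_pi rho chi) as [F HF].
- exact interval_sigma_Sigma01.
- exact interval_pi_Pi01.
- intro n; rewrite HA, HB; split.
  + intros (_ & p & _ & x & _ & a & _ & b & _ & -> & Ha & Hb & Hax & Hxb) w.
    destruct (less_succ_pair M_RCA0 P p x) as [Hp Hx].
    exists p; split; auto; exists x; split; auto; split; auto; split.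
    { now apply (sub_prod_pair _ _ _ _ _ (proj1 H0) Ha). }
    intros a' _ b' _ Ha' Hb'.
    now rewrite (func_unique _ _ _ _ _ _ H0 Ha' Ha), (func_unique _ _ _ _ _ _ H1 Hb' Hb).
  (* The bound zero already decodes [n] and puts [p] in [P], so endpoints exist. A second instance,
     with a bound above them, tests them; by injectivity of pairing it decodes the same [p] and
     [x]. *)
  + intro H; destruct (H zero) as (p & _ & x & _ & En & Hp & _).
    destruct (func_value _ _ _ _ H0 Hp) as [a Ha].
    destruct (func_value _ _ _ _ H1 Hp) as [b Hb].
    destruct (common_bound M_RCA0 P p x a b) as (w & Hpw & Hxw & Haw & Hbw).
    destruct (H w) as (p' & _ & x' & _ & En' & _ & H').
    rewrite En in En'; apply (pair_inj M_RCA0 P) in En'; destruct En'; subst p' x'.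
    exists w, p; split; auto; exists x; split; auto; exists a; split; auto.
    exists b; split; auto; repeat split; auto; now apply (H' a Haw b Hbw).
- exists F; split.
  { intros n Hn; apply HF, HA in Hn.
    destruct Hn as (_ & p & _ & x & _ & a & _ & b & _ & -> & Ha & _ & Hax & _).
    exists p, x; split; [|split; auto].
    - now apply (sub_prod_pair _ _ _ _ _ (proj1 H0) Ha).
    - now apply (le_mem L S HL a x). }
  intros p x; rewrite HF, HA; split.
  + intros (_ & p' & _ & x' & _ & a & _ & b & _ & E & H).
    apply (pair_inj M_RCA0 P) in E; destruct E; subst; eauto.
  + intros (a & b & H).
    destruct (common_bound M_RCA0 P p x a b) as (w & Hpw & Hxw & Haw & Hbw).
    exists w, p; split; auto; exists x; split; auto; exists a; split; auto.
    exists b; auto.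
Qed.

(** Serves both passages from endpoints to sections: the 1-1 case also has (c3) and thus obtains
    (i3). *)
Lemma sections_of_closed_intervals P R L S f0 f1 :
  m_linear_order L S -> m_func f0 P L -> m_func f1 P L ->
  m_c1 P S f0 f1 -> m_c2 P R S f0 f1 -> m_c5 P S f0 f1 ->
  exists F, m_sub_prod F P L /\ m_i1 P L S F /\ m_i2 P R S F /\
    (m_c3 P f0 f1 -> m_i3 P F) /\ m_i4 P F.
Proof.
intros HL H0 H1 C1 C2 C5.
destruct (closed_intervals_exist P L S f0 f1 HL H0 H1) as (F & HF & HFE).
assert (HFp : forall p, mem p P -> exists a b,
  mem (pair p a) f0 /\ mem (pair p b) f1 /\ m_le S a b /\
  (forall x, mem (pair p x) F <-> m_le S a x /\ m_le S x b)).
{ intros p Hp; destruct (C1 p Hp) as (a & b & Ha & Hb & Hab).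
  exists a, b; do 3 (split; auto); intro x; rewrite HFE; split; [|eauto].
  intros (a' & b' & Ha' & Hb' & H).
  now rewrite (func_unique _ _ _ _ _ _ H0 Ha Ha'), (func_unique _ _ _ _ _ _ H1 Hb Hb'). }
(* A section contains its two endpoints and is therefore nonempty and determines them. *)
assert (HFL : forall p a b, m_le S a b ->
  (forall x, mem (pair p x) F <-> m_le S a x /\ m_le S x b) ->
  mem (pair p a) F /\ mem (pair p b) F).
{ intros p a b Hab Hp; destruct (le_mem _ _ HL _ _ Hab).
  assert (m_le S a a /\ m_le S b b) by (split; now apply (le_refl L S HL)).
  split; apply Hp; tauto. }
exists F; split; [exact HF|]; split; [|split; [|split]].
- intros p Hp; destruct (HFp p Hp) as (a & b & _ & _ & Hab & Hx); split.
  + exists a; now apply (HFL p a b).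
  + intros x y z Hpx Hpy _ Hxz Hzy; apply Hx in Hpx, Hpy; apply Hx.
    split; [apply (le_trans L S HL a x z)|apply (le_trans L S HL z y b)]; tauto.
- intros p q Hp Hq.
  destruct (HFp p Hp) as (a & b & _ & Hb & Hab & Hpx).
  destruct (HFp q Hq) as (c & d & Hc & _ & Hcd & Hqx).
  rewrite (C2 p q Hp Hq), (values_iff _ _ _ _ _ _ _ _ _ H1 H0 Hb Hc); split.
  + intros Hbc x y Hx Hy; apply Hpx in Hx; apply Hqx in Hy.
    apply (le_lt_trans L S HL x b y); [tauto|].
    apply (lt_le_trans L S HL b c y); tauto.
  + intro H; apply H; [now apply (HFL p a b)|now apply (HFL q c d)].
- intros C3 p q Hp Hq Hpq E.
  destruct (HFp p Hp) as (a & b & Ha & Hb & Hab & Hpx).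
  destruct (HFp q Hq) as (c & d & Hc & Hd & Hcd & Hqx).
  destruct (HFL p a b Hab Hpx) as [Hpa Hpb], (HFL q c d Hcd Hqx) as [Hqc Hqd].
  (* Equal sections contain each other's endpoints, so the endpoints coincide, against (c3). *)
  apply E, Hqx in Hpa, Hpb; apply E, Hpx in Hqc, Hqd.
  destruct (C3 p q Hp Hq Hpq) as [H|H]; unfold m_value_neq in H.
  + rewrite (values_iff _ _ _ _ _ _ _ _ _ H0 H0 Ha Hc) in H; apply H.
    apply (le_antisym L S HL); tauto.
  + rewrite (values_iff _ _ _ _ _ _ _ _ _ H1 H1 Hb Hd) in H; apply H.
    apply (le_antisym L S HL); tauto.
- intros p q Hp Hq Hsub.
  destruct (HFp p Hp) as (a & b & Ha & Hb & Hab & Hpx).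
  destruct (HFp q Hq) as (c & d & Hc & Hd & Hcd & Hqx).
  destruct (HFL p a b Hab Hpx) as [Hpa Hpb].
  apply Hsub, Hqx in Hpa, Hpb.
  (* Inclusion gives [c <= a] and [b <= d]. If [c < a], then (c5) yields [d < b], a
     contradiction. *)
  assert (Hac : a = c).
  { apply NNPP; intro Hne; apply (lt_not_le L S HL d b); [|tauto].
    apply (values_iff _ _ _ _ _ _ _ _ _ H1 H1 Hd Hb), (C5 q p Hq Hp).
    apply (values_iff _ _ _ _ _ _ _ _ _ H0 H0 Hc Ha); split; auto; tauto. }
  (* If [b < d], then (c5) yields [a < c], against [a = c]. *)
  assert (Hbd : b = d).
  { apply NNPP; intro Hne; apply (lt_irrefl S a); rewrite Hac at 2.
    apply (values_iff _ _ _ _ _ _ _ _ _ H0 H0 Ha Hc), (C5 p q Hp Hq).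
    apply (values_iff _ _ _ _ _ _ _ _ _ H1 H1 Hb Hd); split; auto; tauto. }
  intro x; rewrite Hpx, Hqx, Hac, Hbd; reflexivity.
Qed.

(** Otherwise linearity would place all of [F(p)] strictly before [F(q)], and (i2) would give
    [p < q]. *)
Lemma not_le_sections P R L S F p q :
  m_linear_order L S -> m_sub_prod F P L -> m_i2 P R S F ->
  mem p P -> mem q P -> ~ m_le R p q ->
  exists x y, mem (pair p x) F /\ mem (pair q y) F /\ m_le S y x.
Proof.
intros HL HF H2 Hp Hq Hpq; apply NNPP; intro H; apply Hpq.
apply (H2 p q Hp Hq); intros x y Hx Hy; apply NNPP; intro Hxy; apply H.
exists x, y; repeat split; auto; apply (not_lt_le L S HL); auto.
- now apply (sub_prod_pair _ _ _ _ _ HF Hx).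
- now apply (sub_prod_pair _ _ _ _ _ HF Hy).
Qed.

Lemma interval_no_two_plus_two P R : m_interval_order P R -> m_no_two_plus_two P R.
Proof.
intros (L & S & F & HL & HF & _ & H2) p0 q0 p1 q1 Hp0 Hq0 Hp1 Hq1 H0 H1.
apply NNPP; intro H; apply not_or_and in H; destruct H as [N0 N1].
destruct (not_le_sections P R L S F p0 q1) as (x & y & Hx & Hy & Hyx); auto.
destruct (not_le_sections P R L S F p1 q0) as (x' & y' & Hx' & Hy' & Hyx'); auto.
(* The points lie in [F(p0)], [F(q1)] for [x], [y] and in [F(p1)], [F(q0)] for [x'], [y']; the
   strict steps of the cycle come from (i2). *)
apply (lt_irrefl S x).
apply (lt_le_trans L S HL x y' x); [now apply (H2 p0 q0 Hp0 Hq0)|].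
apply (le_trans L S HL y' x' x); auto.
apply (le_trans L S HL x' y x); auto.
now apply (H2 p1 q1 Hp1 Hq1).
Qed.

(** A [q] incomparable to [p0 < p1 < p2] has points on both sides of [F(p1)], so
    [F(p1)] is contained in [F(q)] by convexity, but the left point is not in it. *)
Lemma proper_no_three_plus_one P R :
  m_proper_interval_order P R -> m_no_three_plus_one P R.
Proof.
intros (L & S & F & HL & HF & I1 & I2 & I4) p0 p1 p2 q Hp0 Hp1 Hp2 Hq H0 H1.
apply NNPP; intro H; apply not_or_and in H; destruct H as [N0 N1].
destruct (not_le_sections P R L S F p0 q) as (x & y & Hx & Hy & Hyx); auto.
destruct (not_le_sections P R L S F q p2) as (y' & z & Hy' & Hz & Hzy); auto.
assert (Hl : forall u, mem (pair p1 u) F -> m_lt S y u).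
{ intros u Hu; apply (le_lt_trans L S HL y x u); auto; now apply (I2 p0 p1 Hp0 Hp1). }
assert (Hr : forall u, mem (pair p1 u) F -> m_lt S u y').
{ intros u Hu; apply (lt_le_trans L S HL u z y'); auto; now apply (I2 p1 p2 Hp1 Hp2). }
apply (lt_irrefl S y), Hl, (I4 p1 q Hp1 Hq); auto.
intros u Hu; apply (proj2 (I1 q Hq) y y' u); auto.
- now apply (sub_prod_pair _ _ _ _ _ HF Hu).
- now apply Hl.
- now apply Hr.
Qed.

Lemma c4_c3 P f0 f1 : m_c4 P f0 f1 -> m_c3 P f0 f1.
Proof. intros C4 p q Hp Hq Hpq; left; now apply (C4 p q Hp Hq). Qed.

End IntervalOrders.

(** * The twelve implications *)

Theorem theorem6p4 :
  (provable RCA0 (every proper_interval_order interval_order) /\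
   provable RCA0 (every proper_one_one_interval_order one_one_interval_order) /\
   provable RCA0 (every proper_closed_interval_order closed_interval_order) /\
   provable RCA0 (every proper_one_one_closed_interval_order
                        one_one_closed_interval_order) /\
   provable RCA0 (every proper_distinguishing_interval_order
                        distinguishing_interval_order)) /\
  provable RCA0 (every proper_distinguishing_interval_order
                       proper_one_one_closed_interval_order) /\
  (provable RCA0 (every proper_one_one_interval_order proper_interval_order) /\
   provable RCA0 (every proper_one_one_closed_interval_order
                        proper_closed_interval_order)) /\
  (provable RCA0 (every proper_closed_interval_order proper_interval_order) /\
   provable RCA0 (every proper_one_one_closed_interval_order
                        proper_one_one_interval_order)) /\
  (provable RCA0 (every proper_interval_order no_two_plus_two) /\
   provable RCA0 (every proper_interval_order no_three_plus_one)).
Proof.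
repeat split; (eapply every_provable;
  [eauto using denotes_interval_order, denotes_proper_interval_order,
     denotes_one_one_interval_order, denotes_proper_one_one_interval_order,
     denotes_closed_interval_order, denotes_proper_closed_interval_order,
     denotes_one_one_closed_interval_order,
     denotes_proper_one_one_closed_interval_order,
     denotes_distinguishing_interval_order,
     denotes_proper_distinguishing_interval_order,
     denotes_no_two_plus_two, denotes_no_three_plus_one..
  |intros M HM P R _ H]).
- destruct H as (L & S & F & H); exists L, S, F; tauto.
- destruct H as (L & S & F & H); exists L, S, F; tauto.
- destruct H as (L & S & f0 & f1 & H); exists L, S, f0, f1; tauto.
- destruct H as (L & S & f0 & f1 & H); exists L, S, f0, f1; tauto.
- destruct H as (L & S & f0 & f1 & H); exists L, S, f0, f1; tauto.
(* Item (ii): the same representation works, with (c3) obtained from (c4). *)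
- destruct H as (L & S & f0 & f1 & H); exists L, S, f0, f1.
  assert (m_c3 P f0 f1) by now apply c4_c3. tauto.
- destruct H as (L & S & F & H); exists L, S, F; tauto.
- destruct H as (L & S & f0 & f1 & H); exists L, S, f0, f1; tauto.
(* Item (iv): the linear order is kept, and the endpoints are replaced by the closed intervals they
   bound. *)
- destruct H as (L & S & f0 & f1 & HL & H0 & H1 & C1 & C2 & C5).
  destruct (sections_of_closed_intervals HM P R L S f0 f1) as (F & H); auto.
  exists L, S, F; tauto.
- destruct H as (L & S & f0 & f1 & HL & H0 & H1 & C1 & C2 & C3 & C5).
  destruct (sections_of_closed_intervals HM P R L S f0 f1) as (F & H); auto.
  exists L, S, F; tauto.
- apply interval_no_two_plus_two; auto.
  destruct H as (L & S & F & H); exists L, S, F; tauto.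
- now apply proper_no_three_plus_one.
Qed.
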